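(* The following problem (P) is solvable in polynomial time. Given a set $P$ of $N$ jobs with colors in $\{0,1\}$, where any two distinct jobs of the same color have distinct process temperatures, and given $\hat{k} \leq \min\{N_0,N_1\}+2$, where $N_c$ is the number of jobs of color $c$ in $P$: find a schedule $S$ of $P$ whose total number of color changes satisfies $C(S)\le\hat k$ and whose total process temperature change $T(S)$ is minimal among all schedules of $P$ with at most $\hat k$ color changes.
   Context: A job $p$ is associated with a pair $(t(p),c(p))$, where $t(p)\in(0,\infty)$ is its process temperature and $c(p)\in\{0,1\}$ is its color. A schedule of $P$ is a sequence $S=(S_1,\ldots,S_N)$ containing each job of $P$ exactly once. For a schedule $S$, the total number of color changes and the total process temperature change are $$C(S) := \sum_{i=1}^{N-1}|c(S_{i+1})-c(S_i)|,\qquad T(S) := \sum_{i=1}^{N-1}|t(S_{i+1})-t(S_i)|.$$ *)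

(* Defs.v *)
From mathcomp Require Import all_boot all_order all_algebra.
From mathcomp Require Import reals.

Set Implicit Arguments.
Unset Strict Implicit.
Unset Printing Implicit Defensive.

Import Order.TTheory GRing.Theory Num.Theory.
Local Open Scope ring_scope.

(** * Polynomial time

    Inputs contain real numbers, so the machine is a uniform real RAM: while
    programs over arrays of naturals (counters, addresses) and arrays of reals,
    with indirect addressing and unit cost per elementary operation.
    - Reals can only be moved, added, subtracted and compared: there is no
      conversion from reals to naturals (rounding), no multiplication and no
      real constant.
    - Naturals have addition and truncated subtraction but no multiplication,
      so a run of [t] steps only produces naturals of O(t + input size) bits,
      which is what makes unit cost legitimate. *)

Inductive nexp : Type :=
| NConst of nat
| NLoad of nat & nexp                       (* (array, index) *)
| NAdd of nexp & nexp
| NSub of nexp & nexp.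

Inductive rexp : Type :=
| RLoad of nat & nexp
| RAdd of rexp & rexp
| RSub of rexp & rexp.

Inductive bexp : Type :=
| BLeN of nexp & nexp
| BLeR of rexp & rexp
| BNot of bexp
| BAnd of bexp & bexp.

Inductive cmd : Type :=
| Skip
| StoreN of nat & nexp & nexp               (* (array, index, value) *)
| StoreR of nat & nexp & rexp
| Seq of cmd & cmd
| If of bexp & cmd & cmd
| While of bexp & cmd.

Record state (R : realType) : Type := State {
  nmem : nat -> nat -> nat;                 (* array, index *)
  rmem : nat -> nat -> R
}.

Definition upd (A : Type) (m : nat -> nat -> A) (a i : nat) (v : A) :
    nat -> nat -> A :=
  fun b j => if (b == a) && (j == i) then v else m b j.

Fixpoint neval (R : realType) (s : state R) (e : nexp) : nat :=
  match e with
  | NConst n => n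
  | NLoad a i => nmem s a (neval s i)
  | NAdd e1 e2 => (neval s e1 + neval s e2)%N
  | NSub e1 e2 => (neval s e1 - neval s e2)%N
  end.

Fixpoint reval (R : realType) (s : state R) (e : rexp) : R :=
  match e with
  | RLoad a i => rmem s a (neval s i)
  | RAdd e1 e2 => reval s e1 + reval s e2
  | RSub e1 e2 => reval s e1 - reval s e2
  end.

Fixpoint beval (R : realType) (s : state R) (b : bexp) : bool :=
  match b with
  | BLeN e1 e2 => (neval s e1 <= neval s e2)%N
  | BLeR e1 e2 => reval s e1 <= reval s e2
  | BNot b1 => ~~ beval s b1
  | BAnd b1 b2 => beval s b1 && beval s b2
  end.

Fixpoint ncost (e : nexp) : nat :=
  match e with
  | NConst _ => 1
  | NLoad _ i => (ncost i).+1
  | NAdd e1 e2 | NSub e1 e2 => (ncost e1 + ncost e2).+1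
  end.

Fixpoint rcost (e : rexp) : nat :=
  match e with
  | RLoad _ i => (ncost i).+1
  | RAdd e1 e2 | RSub e1 e2 => (rcost e1 + rcost e2).+1
  end.

Fixpoint bcost (b : bexp) : nat :=
  match b with
  | BLeN e1 e2 => (ncost e1 + ncost e2).+1
  | BLeR e1 e2 => (rcost e1 + rcost e2).+1
  | BNot b1 => (bcost b1).+1
  | BAnd b1 b2 => (bcost b1 + bcost b2).+1
  end.

(** [exec c s t s']: from [s], the program [c] halts in [s'] after exactly [t]
    elementary operations. *)
Inductive exec (R : realType) : cmd -> state R -> nat -> state R -> Prop :=
| ExSkip s : exec Skip s 0 s
| ExStoreN a i e s :
    exec (StoreN a i e) s (ncost i + ncost e).+1
      (State (upd (nmem s) a (neval s i) (neval s e)) (rmem s))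
| ExStoreR a i e s :
    exec (StoreR a i e) s (ncost i + rcost e).+1
      (State (nmem s) (upd (rmem s) a (neval s i) (reval s e)))
| ExSeq c1 c2 s1 s2 s3 t1 t2 :
    exec c1 s1 t1 s2 -> exec c2 s2 t2 s3 -> exec (Seq c1 c2) s1 (t1 + t2) s3
| ExIfTrue b c1 c2 s s' t :
    beval s b -> exec c1 s t s' -> exec (If b c1 c2) s (bcost b + t) s'
| ExIfFalse b c1 c2 s s' t :
    ~~ beval s b -> exec c2 s t s' -> exec (If b c1 c2) s (bcost b + t) s'
| ExWhileTrue b c s1 s2 s3 t1 t2 :
    beval s1 b -> exec c s1 t1 s2 -> exec (While b c) s2 t2 s3 ->
    exec (While b c) s1 (bcost b + t1 + t2) s3
| ExWhileFalse b c s :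
    ~~ beval s b -> exec (While b c) s (bcost b) s.

Record word (R : realType) : Type := Word {
  wnats : seq nat;
  wreals : seq R
}.

(** Binary length for naturals, one unit per real. *)
Definition word_size (R : realType) (w : word R) : nat :=
  (\sum_(n <- wnats w) (trunc_log 2 n).+1 + size (wreals w))%N.

(** The input is stored in the arrays number 0; all other cells contain 0. *)
Definition init_state (R : realType) (w : word R) : state R :=
  State (fun a i => if a == 0%N then nth 0%N (wnats w) i else 0%N)
        (fun a i => if a == 0%N then nth 0 (wreals w) i else 0).

(** The output is in the natural array number 1, preceded by its length. *)
Definition output (R : realType) (s : state R) : seq nat :=
  mkseq (fun i => nmem s 1 i.+1) (nmem s 1 0).

Record search_problem (R : realType) : Type := SearchProblem {
  input : Type;
  admissible : input -> Prop;
  encode : input -> word R;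
  answer : input -> seq nat -> Prop
}.

Definition poly_time_solvable (R : realType) (Q : search_problem R) : Prop :=
  exists (prog : cmd) (q : {poly nat}), forall x : input Q, admissible x ->
    exists (t : nat) (s : state R),
      [/\ exec prog (init_state (encode x)) t s,
          (t <= q.[word_size (encode x)])%N
        & answer x (output s)].

(** * Jobs and schedules

    The set of jobs is indexed by ['I_njobs]; colors 0 and 1 are the
    booleans, through the coercion to [nat]. *)
Record instance (R : realType) : Type := Instance {
  njobs : nat;
  temp : 'I_njobs -> R;
  color : 'I_njobs -> bool;
  max_changes : nat
}.

Definition ncolor (R : realType) (P : instance R) (c : bool) : nat :=
  #|[set p : 'I_(njobs P) | color p == c]|.

Definition is_schedule (R : realType) (P : instance R)
    (S : seq 'I_(njobs P)) : bool :=
  perm_eq S (enum 'I_(njobs P)).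

(** [zip S (behead S)] lists the pairs [(S_i, S_(i+1))] for [1 <= i < N]. *)
Definition color_changes (R : realType) (P : instance R)
    (S : seq 'I_(njobs P)) : nat :=
  (\sum_(pq <- zip S (behead S)) `|color pq.2 - color pq.1|)%N.

Definition temp_change (R : realType) (P : instance R)
    (S : seq 'I_(njobs P)) : R :=
  \sum_(pq <- zip S (behead S)) `|temp pq.2 - temp pq.1|.

Definition feasible (R : realType) (P : instance R)
    (S : seq 'I_(njobs P)) : Prop :=
  is_schedule S /\ (color_changes S <= max_changes P)%N.

Definition optimal (R : realType) (P : instance R)
    (S : seq 'I_(njobs P)) : Prop :=
  feasible S /\
  forall S' : seq 'I_(njobs P), feasible S' -> temp_change S <= temp_change S'.

Definition admissible_instance (R : realType) (P : instance R) : Prop :=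
  [/\ forall p : 'I_(njobs P), 0 < temp p,
      forall p q : 'I_(njobs P),
        p != q -> color p = color q -> temp p != temp q
    & (max_changes P <= minn (ncolor P false) (ncolor P true) + 2)%N].

Definition encode_instance (R : realType) (P : instance R) : word R :=
  Word [:: njobs P, max_changes P & [seq nat_of_bool (color p) | p <- enum 'I_(njobs P)]]
       [seq temp p | p <- enum 'I_(njobs P)].

(** The answer is 1 followed by an optimal schedule (as job indices), or 0 when
    there is no feasible schedule, i.e. when both colors occur and
    [max_changes P = 0]. *)
Definition correct_answer (R : realType) (P : instance R) (out : seq nat) : Prop :=
  (exists2 S : seq 'I_(njobs P),
     optimal S & out = 1%N :: [seq nat_of_ord p | p <- S]) \/
  ((forall S : seq 'I_(njobs P), ~ feasible S) /\ out = [:: 0%N]).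

Definition scheduling_problem (R : realType) : search_problem R :=
  SearchProblem (@admissible_instance R) (@encode_instance R) (@correct_answer R).

(* Main.v *)
Require Import Defs.
From mathcomp Require Import all_boot all_order all_algebra reals.
From mathcomp Require Import ssrAC zify ring lra.

Set Implicit Arguments.
Unset Strict Implicit.
Unset Printing Implicit Defensive.

Import Order.TTheory GRing.Theory Num.Theory.
Local Open Scope ring_scope.

(** Insert the jobs in the order of increasing temperature. A partial schedule
    is then a sequence of fragments separated by gaps, to be filled by hotter
    jobs, and what matters for its completion is only its signature: the list
    of the colors of the two jobs that surround each gap. A job inserted at
    temperature [t] contributes [t] for every link to an earlier job and [- t]
    for every link to a later one.

    Suppose that, in a schedule, two links enter the set of the [i] coldest jobs
    at jobs of the same color. Reversing the part of the schedule between them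
    increases neither the temperature change nor the number of color changes,
    and shortens the schedule measured by ranks. So some optimal schedule
    enters every such set at most once per color, hence has at most three gaps
    at each stage. This leaves a constant number of signatures, and a dynamic
    program over (number of remaining jobs, signature, remaining color changes)
    finds an optimal schedule. *)

(** * Bounded loops on the real RAM *)

(** Why three gaps: each gap, except possibly one at the end of the schedule, is closed by a link
    that enters the set of cold jobs, and there is at most one such link per color. Why ranks: jobs
    of different colors may share a temperature, and then a reversal can leave both the temperature
    change and the number of color changes as they are. Ranks never tie, so the length in ranks
    drops strictly and uncrossing terminates. Why a constant number of signatures matters beyond
    running time: the array numbers of the machine are constants of the program text, so a signature
    becomes the name of an array, and the program contains one block of instructions per transition.
    Why the bound on the color changes matters: it arrives in binary, while the table has one column
    per remaining budget. Being at most the number of jobs plus two, it keeps the table polynomial.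
    Why rows count the remaining jobs: the table is filled from the hottest job down, so a schedule
    is rebuilt by following the stored transitions from the single initial gap in order of
    insertion. *)

(** Every loop runs up to one fixed bound, which makes running times polynomial
    by construction. *)
Inductive prog : Type :=
| PSkip
| PN of nat & nexp & nexp
| PR of nat & nexp & rexp
| PSeq of prog & prog
| PIf of bexp & prog & prog
| PFor of nat & prog.

Definition bound_cell : nexp := NLoad 2 (NConst 0).
Definition var (a : nat) : nexp := NLoad a (NConst 0).

Fixpoint compile (p : prog) : cmd :=
  match p with
  | PSkip => Skip
  | PN a i e => StoreN a i e
  | PR a i e => StoreR a i e
  | PSeq p1 p2 => Seq (compile p1) (compile p2)
  | PIf b p1 p2 => If b (compile p1) (compile p2)
  | PFor a p1 =>
      Seq (StoreN a (NConst 0) (NConst 0))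
        (While (BNot (BLeN bound_cell (var a)))
          (Seq (compile p1) (StoreN a (NConst 0) (NAdd (var a) (NConst 1)))))
  end.

Definition setN (R : realType) (s : state R) a i v :=
  State (upd (nmem s) a i v) (rmem s).
Definition setR (R : realType) (s : state R) a i v :=
  State (nmem s) (upd (rmem s) a i v).

Definition incr (R : realType) (a : nat) (s : state R) :=
  setN s a 0 (nmem s a 0 + 1).

Fixpoint sem (R : realType) (p : prog) (s : state R) : state R :=
  match p with
  | PSkip => s
  | PN a i e => setN s a (neval s i) (neval s e)
  | PR a i e => setR s a (neval s i) (reval s e)
  | PSeq p1 p2 => sem p2 (sem p1 s)
  | PIf b p1 p2 => if beval s b then sem p1 s else sem p2 s
  | PFor a p1 =>
      iter (nmem s 2 0) (fun s1 => incr a (sem p1 s1)) (setN s a 0 0)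
  end.

Fixpoint writes (p : prog) (a : nat) : bool :=
  match p with
  | PSkip | PR _ _ _ => false
  | PN b _ _ => a == b
  | PSeq p1 p2 | PIf _ p1 p2 => writes p1 a || writes p2 a
  | PFor b p1 => (a == b) || writes p1 a
  end.

Fixpoint writesR (p : prog) (a : nat) : bool :=
  match p with
  | PSkip | PN _ _ _ => false
  | PR b _ _ => a == b
  | PSeq p1 p2 | PIf _ p1 p2 => writesR p1 a || writesR p2 a
  | PFor _ p1 => writesR p1 a
  end.

Fixpoint wf (p : prog) : bool :=
  match p with
  | PSkip | PR _ _ _ | PN _ _ _ => true
  | PSeq p1 p2 | PIf _ p1 p2 => wf p1 && wf p2
  | PFor a p1 => [&& a != 2, ~~ writes p1 2, ~~ writes p1 a & wf p1]
  end%N.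

(** ['X + 10] stands for the value of the bound cell, i.e. for the number of
    iterations of every loop. *)
Fixpoint time_poly (p : prog) : {poly nat} :=
  match p with
  | PSkip => 0
  | PN _ i e => ((ncost i + ncost e).+1)%:P
  | PR _ i e => ((ncost i + rcost e).+1)%:P
  | PSeq p1 p2 => time_poly p1 + time_poly p2
  | PIf b p1 p2 => (bcost b)%:P + (time_poly p1 + time_poly p2)
  | PFor _ p1 => 9%:P + (time_poly p1 + 12%:P) * ('X + 10%:P)
  end.

Section Semantics.
Variable R : realType.
Implicit Types (s : state R) (p : prog).

Lemma updE A (m : nat -> nat -> A) a i v b j :
  upd m a i v b j = if (b == a) && (j == i) then v else m b j.
Proof. by []. Qed.

Lemma sem_frame p a s : ~~ writes p a -> nmem (sem p s) a =1 nmem s a.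
Proof.
elim: p s => [|b i e|b i e|p1 IH1 p2 IH2|b p1 IH1 p2 IH2|b p1 IH1] s //=.
- by move=> /negbTE ab j; rewrite updE ab.
- by rewrite negb_or => /andP[w1 w2] j; rewrite IH2 // IH1.
- by rewrite negb_or => /andP[w1 w2] j; case: ifP => _; rewrite ?IH1 ?IH2.
rewrite negb_or => /andP[/negbTE ab w1] j.
elim: (nmem s 2 0) => [|n IHn] /=; first by rewrite updE ab.
by rewrite updE ab IH1 // IHn.
Qed.

Lemma sem_frameR p a s : ~~ writesR p a -> rmem (sem p s) a =1 rmem s a.
Proof.
elim: p s => [|b i e|b i e|p1 IH1 p2 IH2|b p1 IH1 p2 IH2|b p1 IH1] s //=.
- by move=> /negbTE ab j; rewrite updE ab.
- by rewrite negb_or => /andP[w1 w2] j; rewrite IH2 // IH1.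
- by rewrite negb_or => /andP[w1 w2] j; case: ifP => _; rewrite ?IH1 ?IH2.
move=> w1 j; elim: (nmem s 2 0) => [|n IHn] //=.
by rewrite IH1 // IHn.
Qed.

Definition frame p s s' :=
  (forall b, ~~ writes p b -> nmem s' b =1 nmem s b) /\
  (forall b, ~~ writesR p b -> rmem s' b =1 rmem s b).

(** Well-formedness keeps the body away from its counter and from the bound, so the number of
    iterations is fixed on entry. The induction step receives [frame] for free, and invariants need
    not mention the arrays that the loop leaves alone. *)
Lemma sem_for_ind (I : nat -> state R -> Prop) a p s :
  wf (PFor a p) ->
  I 0 (setN s a 0 0) ->
  (forall j s', (j < nmem s 2 0)%N -> nmem s' a 0 = j ->
     frame (PFor a p) s s' -> I j s' -> I j.+1 (incr a (sem p s'))) ->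
  I (nmem s 2 0) (sem (PFor a p) s).
Proof.
move=> /= /and4P[a2 w2 wa _] I0 IS.
have H n : (n <= nmem s 2 0)%N ->
  let s' := iter n (fun s1 => incr a (sem p s1)) (setN s a 0 0) in
  [/\ nmem s' a 0 = n, frame (PFor a p) s s' & I n s'].
  elim: n => [|n IHn] ln /=.
    split=> //; first by rewrite updE !eqxx.
    split=> b //=.
    by rewrite negb_or => /andP[/negbTE ba _] j; rewrite updE ba.
  have [En [FN FR] In] := IHn (ltnW ln).
  split; last exact: IS.
    by rewrite updE !eqxx /= sem_frame //; move: En => /= ->; rewrite addn1.
  split=> b wb j /=; last by rewrite sem_frameR // FR.
  move: (wb) => /=; rewrite negb_or => /andP[/negbTE ba wpb].
  by rewrite updE ba /= sem_frame // FN.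
by have [] := H _ (leqnn _).
Qed.

Lemma exec_compile p s m :
  wf p -> ~~ writes p 2 -> nmem s 2 0 = (m + 10)%N ->
  exists t, exec (compile p) s t (sem p s) /\ (t <= (time_poly p).[m])%N.
Proof.
elim: p s => [|b i e|b i e|p1 IH1 p2 IH2|b p1 IH1 p2 IH2|a p1 IH1] s //=.
- by move=> _ _ _; exists 0%N; split=> //; exact: ExSkip.
- by move=> _ _ _; eexists; rewrite hornerE; split; first exact: ExStoreN.
- by move=> _ _ _; eexists; rewrite hornerE; split; first exact: ExStoreR.
- move=> /andP[f1 f2]; rewrite negb_or => /andP[w1 w2] E.
  have [t1 [e1 l1]] := IH1 s f1 w1 E.
  have [|t2 [e2 l2]] := IH2 (sem p1 s) f2 w2; first by rewrite sem_frame.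
  by exists (t1 + t2)%N; rewrite hornerD leq_add //; split=> //; exact: ExSeq e1 e2.
- move=> /andP[f1 f2]; rewrite negb_or => /andP[w1 w2] E.
  rewrite !hornerD hornerC; case: ifPn => bb.
    have [t1 [e1 l1]] := IH1 s f1 w1 E.
    exists (bcost b + t1)%N; split; first exact: ExIfTrue.
    by apply: leq_add => //; apply: leq_trans l1 _; exact: leq_addr.
  have [t1 [e1 l1]] := IH2 s f2 w2 E.
  exists (bcost b + t1)%N; split; first exact: ExIfFalse.
  by apply: leq_add => //; apply: leq_trans l1 _; exact: leq_addl.
move=> /and4P[a2 w2 wa f1] _ E.
set b := BNot _; set c := Seq (compile p1) _.
pose f s1 := incr a (sem p1 s1).
set T := (time_poly p1).[m].
(* The guard costs 6 and the increment 6, hence 12 per iteration beside the body. The last, failing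
   guard gives the summand 6, and the reset of the counter raises it to the 9 of [time_poly]. *)
have loop k s1 n : nmem s1 2 0 = (m + 10)%N -> nmem s1 a 0 = n ->
    (n + k = m + 10)%N -> exists t, exec (While b c) s1 t (iter k f s1) /\
      (t <= 6 + k * (T + 12))%N.
  elim: k s1 n => [|k IHk] s1 n E2 Ea nk.
    exists (bcost b); split; last by [].
    by apply: ExWhileFalse; rewrite /= E2 Ea -nk addn0 leqnn.
  have [t1 [e1 l1]] := IH1 s1 f1 w2 E2.
  have F2 : nmem (f s1) 2 0 = (m + 10)%N.
    by rewrite /f /= updE (eq_sym 2%N) (negbTE a2) /= sem_frame.
  have Fa : nmem (f s1) a 0 = n.+1.
    by rewrite /f /= updE !eqxx /= sem_frame // Ea addn1.
  have [|t2 [e2 l2]] := IHk (f s1) n.+1 F2 Fa; first by rewrite addSnnS.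
  exists (bcost b + (t1 + 6) + t2)%N; split.
    rewrite iterSr; apply: ExWhileTrue e2; first by rewrite /= E2 Ea; lia.
    by apply: ExSeq e1 _; exact: ExStoreN.
  move: l1 l2; rewrite -/T /=; lia.
have [|||t [et lt]] := loop (m + 10)%N (setN s a 0 0) 0%N.
- by rewrite /= updE (eq_sym 2%N) (negbTE a2).
- by rewrite /= updE !eqxx.
- by [].
exists (3 + t)%N; rewrite E; split; first by apply: ExSeq et; exact: ExStoreN.
rewrite hornerD hornerM !hornerD !hornerC hornerX -/T.
by move: lt; rewrite -[_ + _ * _]/(9 + (T + 12) * (m + 10))%N mulnC; lia.
Qed.

End Semantics.

(** * Uncrossing schedules *)

Section PathSums.
Variables (V : Type) (idx : V) (op : Monoid.com_law idx).
Variable f : nat -> nat -> V.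
Implicit Types s A D M : seq nat.

(** Generic in the monoid and in the cost of a link: temperature change, color changes, length in
    ranks, crossings and adjacent gaps all share the splitting lemmas below. *)
Definition psum s : V := \big[op/idx]_(pq <- zip s (behead s)) f pq.1 pq.2.

Lemma psum_cons a b s : psum (a :: b :: s) = op (f a b) (psum (b :: s)).
Proof. by rewrite /psum /= big_cons. Qed.

Lemma psum0 : psum [::] = idx.
Proof. by rewrite /psum /= big_nil. Qed.

Lemma psum1 a : psum [:: a] = idx.
Proof. by rewrite /psum /= big_nil. Qed.

Lemma psum_cat s1 a s2 :
  psum (s1 ++ a :: s2) = op (psum (rcons s1 a)) (psum (a :: s2)).
Proof.
elim: s1 => [|b [|c s1] IH] /=; first by rewrite psum1 Monoid.mul1m.
  by rewrite psum_cons [psum [:: b; a]]psum_cons psum1 Monoid.mulm1.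
by rewrite psum_cons IH [X in _ = op X _]psum_cons Monoid.mulmA.
Qed.

Lemma psum_rcons s a b :
  psum (rcons (rcons s a) b) = op (psum (rcons s a)) (f a b).
Proof. by rewrite -cats1 cat_rcons psum_cat psum_cons psum1 Monoid.mulm1. Qed.

(** Isolates the two links at the ends of a block. For a symmetric cost, reversing [M] preserves all
    other terms, so only these two links remain to be compared. *)
Lemma psum_mid A a M d D : M != [::] ->
  psum (A ++ a :: M ++ d :: D) =
  op (op (op (psum (rcons A a)) (psum (d :: D))) (psum M))
     (op (f a (head 0%N M)) (f (last 0%N M) d)).
Proof.
case: M => // b M _; rewrite psum_cat /= psum_cons -[b :: _]/((b :: M) ++ d :: D).
rewrite psum_cat; case/lastP: M => [|M c].
  by rewrite psum_cons !psum1 /= !Monoid.mulm1 [RHS]op.[AC (2*2) (1*(3*(4*2)))].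
rewrite -[b :: _]/(rcons (b :: M) c) psum_rcons last_rcons /=.
by rewrite [RHS]op.[AC (3*2) (1*(4*((3*5)*2)))].
Qed.

Hypothesis f_sym : forall a b, f a b = f b a.

Lemma psum_rev s : psum (rev s) = psum s.
Proof.
elim: s => [|a [|b s] IH] //.
by rewrite !rev_cons psum_rcons -rev_cons IH f_sym Monoid.mulmC psum_cons.
Qed.

End PathSums.

Arguments psum {V idx} op f s.

Section Uncrossing.
Variables (R : realType) (t : nat -> R) (col : nat -> bool).
Implicit Types (s A D M xs : seq nat) (L : pred nat).

Definition dist_t a b : R := `|t b - t a|.
Definition dist_c a b : nat := col a != col b.
(** One of the two truncated differences vanishes, so this is the absolute difference of the
    ranks. *)
Definition dist_r xs a b : nat :=
  (index a xs - index b xs + (index b xs - index a xs))%N.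

Definition cross L c a b : bool := [&& a \notin L, b \in L & col b == c].

Definition ncross L c s : nat := psum addn (fun a b => cross L c a b : nat) s.

Lemma ncross_gt0 L c s : (0 < ncross L c s)%N ->
  exists A a b D, s = A ++ a :: b :: D /\ cross L c a b.
Proof.
elim: s => [|a [|b s] IH]; rewrite /ncross ?psum0 ?psum1 //.
rewrite psum_cons.
case: (boolP (cross L c a b)) => [ab _|_].
  by exists [::], a, b, s.
rewrite /= add0n => /IH[A [a' [b' [D [-> ab]]]]].
by exists (a :: A), a', b', D.
Qed.

Lemma ncross_gt1 L c s : (1 < ncross L c s)%N ->
  exists A a M d D, [/\ s = A ++ a :: M ++ d :: D, M != [::],
    cross L c a (head 0%N M) & cross L c (last 0%N M) d].
Proof.
elim: s => [|a [|b s] IH]; rewrite /ncross ?psum0 ?psum1 //.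
rewrite psum_cons.
case: (boolP (cross L c a b)) => [ab|_].
  rewrite /= ltnS => /ncross_gt0[A [a' [b' [D [E ab']]]]].
  (* The block starts at [b], where the first crossing enters, and ends at [a'], from which the
     second one departs. *)
  exists [::], a, (rcons A a'), b', D; rewrite last_rcons cat_rcons -E.
  split=> //; first by case: A {E}.
  suff -> : head 0%N (rcons A a') = b by [].
  by case: A E => [|? ?] [].
rewrite /= add0n => /IH[A [a' [M [d [D [-> M0 ab cd]]]]]].
by exists (a :: A), a', M, d, D.
Qed.

Lemma dist_tC a b : dist_t a b = dist_t b a.
Proof. exact: distrC. Qed.

Lemma dist_cC a b : dist_c a b = dist_c b a.
Proof. by rewrite /dist_c eq_sym. Qed.

Lemma dist_rC xs a b : dist_r xs a b = dist_r xs b a.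
Proof. by rewrite /dist_r addnC. Qed.

(** The right side exceeds the left by twice the distance from [maxn b d] up to [minn a e], which is
    positive because [i] separates them. *)
Lemma uncross_dist i a b e d :
  (i <= a -> b < i -> i <= e -> d < i ->
  a - e + (e - a) + (b - d + (d - b)) < a - b + (b - a) + (e - d + (d - e)))%N.
Proof.
move=> ia bi ie di.
have [ba bl de dl] : [/\ b < a, b < e, d < e & d < a]%N by split; lia.
have -> : (b - a = 0)%N by lia.
have -> : (d - e = 0)%N by lia.
by case: (leqP a e) => ?; case: (leqP b d) => ?; lia.
Qed.

(** 2-opt: when two links enter the prefix [take i xs] at jobs of equal color,
    reversing the part of the schedule between them removes both crossings. *)
Lemma uncross xs s i c :
  uniq xs -> sorted (fun a b => t a <= t b) xs -> perm_eq s xs ->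
  (1 < ncross (mem (take i xs)) c s)%N ->
  exists s', [/\ perm_eq s' xs, psum +%R dist_t s' <= psum +%R dist_t s,
    (psum addn dist_c s' <= psum addn dist_c s)%N &
    (psum addn (dist_r xs) s' < psum addn (dist_r xs) s)%N].
Proof.
move=> Ux St Ps /ncross_gt1[A [a [M [d [D [E M0 ab cd]]]]]].
have inx z : z \in s -> z \in xs by rewrite (perm_mem Ps).
set b := head 0%N M in ab; set e := last 0%N M in cd.
have bM : b \in M by rewrite /b; case: (M) M0 => //= ? ?; rewrite mem_head.
have eM : e \in M by rewrite /e; case: (M) M0 => //= ? ? _; rewrite mem_last.
have ax : a \in xs by apply: inx; rewrite E !(mem_cat, inE) eqxx !orbT.
have dx : d \in xs by apply: inx; rewrite E !(mem_cat, inE) eqxx !orbT.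
have bx : b \in xs by apply: inx; rewrite E !(mem_cat, inE) bM !orbT.
have ex : e \in xs by apply: inx; rewrite E !(mem_cat, inE) eM !orbT.
have lt_t u v : u \in xs -> v \in xs -> (index u xs < index v xs)%N -> t u <= t v.
  move=> ux vx uv.
  have := @sorted_leq_index _ (fun a b => t a <= t b) _ _ xs St u v ux vx (ltnW uv).
  by apply => // x y z; apply: le_trans.
case/and3P: ab; rewrite /= in_take // -leqNgt => ia; rewrite in_take // => ib /eqP cb.
case/and3P: cd; rewrite /= in_take // -leqNgt => ie; rewrite in_take // => id /eqP cd.
exists (A ++ a :: rev M ++ d :: D).
have rM0 : rev M != [::] by rewrite -size_eq0 size_rev size_eq0.
have hrM : head 0%N (rev M) = e by rewrite /e -[M in last _ M]revK; case: (rev M) rM0 => //= x r; rewrite rev_cons last_rcons.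
have lrM : last 0%N (rev M) = b by rewrite /b; case: (M) M0 => //= x r; rewrite rev_cons last_rcons.
split.
- apply: perm_trans Ps; rewrite E perm_cat2l perm_cons perm_cat2r.
  by rewrite perm_rev.
- rewrite E !psum_mid // hrM lrM psum_rev; last exact: dist_tC.
  rewrite /= lerD2l /dist_t -/b -/e.
  have [h1 h2] := (lt_t b a bx ax (leq_trans ib ia), lt_t d a dx ax (leq_trans id ia)).
  have [h3 h4] := (lt_t b e bx ex (leq_trans ib ie), lt_t d e dx ex (leq_trans id ie)).
  rewrite (ler0_norm (_ : t b - t a <= 0)) ?subr_le0 //.
  rewrite (ler0_norm (_ : t d - t e <= 0)) ?subr_le0 //.
  by case: (ger0P (t e - t a)) => ?; case: (ger0P (t d - t b)) => ?; lra.
(* Both entered jobs have color [c]: the new link between them is free, and the link from [a] to [e]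
   obeys the triangle inequality through [c]. *)
- rewrite E !psum_mid // hrM lrM psum_rev; last exact: dist_cC.
  rewrite /= leq_add2l /dist_c -/b -/e cb cd eqxx addn0.
  by case: (col a); case: (col e); case: (c).
- rewrite E !psum_mid // hrM lrM psum_rev; last exact: dist_rC.
  rewrite /= ltn_add2l /dist_r -/b -/e.
  exact: uncross_dist ia ib ie id.
Qed.

Definition tame xs s := forall i c, (ncross (mem (take i xs)) c s <= 1)%N.

Lemma tame_exists xs s :
  uniq xs -> sorted (fun a b => t a <= t b) xs -> perm_eq s xs ->
  exists s', [/\ perm_eq s' xs, psum +%R dist_t s' <= psum +%R dist_t s,
    (psum addn dist_c s' <= psum addn dist_c s)%N & tame xs s'].
Proof.
move=> Ux St; have [n] := ubnP (psum addn (dist_r xs) s).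
elim: n s => // n IH s; rewrite ltnS => ln Ps.
have [T|[i [c H]]] : tame xs s \/
    exists i c, (1 < ncross (mem (take i xs)) c s)%N.
  (* Prefixes stop changing at [size xs], so the search for a bad [i] is finite. *)
  pose bad i := [exists c, (1 < ncross (mem (take i xs)) c s)%N].
  have [/hasP[i _ /existsP[c Hc]]|/hasPn H] :=
      boolP (has bad (iota 0 (size xs).+1)).
    by right; exists i, c.
  left=> i c; rewrite leqNgt; apply/negP => Hi.
  have {}Hi : bad (minn i (size xs)).
    by apply/existsP; exists c; rewrite take_min take_size.
  by move: (H (minn i (size xs))); rewrite Hi mem_iota /= add0n ltnS geq_minr => /(_ isT).
- by exists s.
have [s1 [P1 T1 C1 r1]] := uncross Ux St Ps H.
have [s2 [P2 T2 C2 t2]] := IH s1 (leq_trans r1 ln) P1.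
by exists s2; split=> //; [exact: le_trans T2 T1|exact: leq_trans C2 C1].
Qed.

End Uncrossing.

(** * Partial schedules with gaps *)

Definition gap : Type := (option bool * option bool)%type.

(** A transition consists of a signature, the color of the job to insert, the
    position of the gap that receives it, and two booleans telling whether a gap
    remains on the left and on the right of the job. *)
Definition transition : Type := (seq gap * bool * nat * (bool * bool))%type.

Definition tsrc (tr : transition) : seq gap := tr.1.1.1.
Definition tcol (tr : transition) : bool := tr.1.1.2.
Definition tgap (tr : transition) : nat := tr.1.2.
Definition tkeep (tr : transition) : bool * bool := tr.2.
Definition told (tr : transition) : gap := nth (None, None) (tsrc tr) (tgap tr).

Definition tdst (tr : transition) : seq gap :=
  take (tgap tr) (tsrc tr)
  ++ (nseq (tkeep tr).1 ((told tr).1, Some (tcol tr))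
      ++ nseq (tkeep tr).2 (Some (tcol tr), (told tr).2))
  ++ drop (tgap tr).+1 (tsrc tr).

Definition color_step (o : option bool) (c : bool) : nat :=
  if o is Some d then d != c else 0%N.

(** A side that keeps its gap forms no link yet; its color change is charged to the transition that
    closes the gap there. *)
Definition tdelta (tr : transition) : nat :=
  (~~ (tkeep tr).1 * color_step (told tr).1 (tcol tr)
   + ~~ (tkeep tr).2 * color_step (told tr).2 (tcol tr))%N.

Definition tplus (tr : transition) : nat :=
  (~~ (tkeep tr).1 && ((told tr).1 != None)
   + (~~ (tkeep tr).2 && ((told tr).2 != None)))%N.

(** A kept gap will have to receive a later job, so it already stands for one link to a later
    job. *)
Definition tminus (tr : transition) : nat := ((tkeep tr).1 + (tkeep tr).2)%N.

Section Arrangements.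
Variables (R : realType) (t : nat -> R) (col : nat -> bool).
Implicit Types (s xs : seq nat) (L : pred nat).

(** In an arrangement, [0] marks both ends, [1] is a gap, and jobs are the
    numbers from [2] on. *)
Definition weight a b : R :=
  if (a == 0) || (b == 0) then 0
  else if a == 1 then - t b else if b == 1 then - t a else `|t b - t a|.

Definition change a b : nat := [&& (1 < a), (1 < b) & col a != col b]%N.

Definition adj_gaps a b : nat := (a == 1%N) && (b == 1%N).

Definition side a : option bool := if (1 < a)%N then Some (col a) else None.

Fixpoint gaps p s : seq gap :=
  if s is a :: s' then
    if a == 1%N then (side p, side (head 0%N s')) :: gaps a s' else gaps a s'
  else [::].

Definition filling x (k : bool * bool) : seq nat :=
  nseq k.1 1%N ++ x :: nseq k.2 1%N.

Lemma gaps_cat p s1 a s2 : a != 1%N ->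
  gaps p (s1 ++ a :: s2) = gaps p (rcons s1 a) ++ gaps a s2.
Proof.
move=> a1; elim: s1 p => [|b s1 IH] p /=; first by rewrite (negbTE a1).
rewrite !IH; case: ifP => // _; congr ((_, side _) :: _).
by case: s1 {IH}.
Qed.

Lemma size_gaps p s : size (gaps p s) = count_mem 1%N s.
Proof. by elim: s p => //= a s IH p; case: ifP => _ /=; rewrite IH. Qed.

Section Fill.
Variables (b1 b2 : seq nat) (l r x : nat) (k : bool * bool).
Let s := b1 ++ l :: 1%N :: r :: b2.
Let s' := b1 ++ l :: filling x k ++ r :: b2.
Let tr : transition := (gaps 0 s, col x, size (gaps 0 (rcons b1 l)), k).
Hypotheses (l1 : l != 1%N) (r1 : r != 1%N) (x1 : (1 < x)%N).

Let gapsE : gaps 0 s = gaps 0 (rcons b1 l) ++ (side l, side r) :: gaps r b2.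
Proof. by rewrite gaps_cat //= (negbTE r1). Qed.

Let oldE : told tr = (side l, side r).
Proof. by rewrite /told /= /tsrc /tgap /= gapsE nth_cat ltnn subnn. Qed.

Lemma fill_gap_lt : (tgap tr < size (tsrc tr))%N.
Proof. by rewrite /tgap /tsrc /= gapsE size_cat /= addnS ltnS leq_addr. Qed.

Lemma fill_gaps : gaps 0 s' = tdst tr.
Proof.
have x1' : (x == 1%N) = false by case: (x) x1 => [|[]].
rewrite /tdst oldE /tgap /tsrc /tkeep /tcol /= gapsE.
rewrite take_size_cat // drop_cat ltnNge leqnSn /= subSn // subnn drop1 /=.
rewrite gaps_cat //; congr (_ ++ _); rewrite /filling.
by case: (k) => [[] []] /=; rewrite ?x1' /= ?(negbTE r1) //= /side ?x1.
Qed.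

Lemma fill_adj : psum addn adj_gaps s = 0%N -> psum addn adj_gaps s' = 0%N.
Proof.
have x1' : (x == 1%N) = false by case: (x) x1 => [|[]].
rewrite !psum_cat /filling !psum_cons; case: (k) => [[] []] /=;
  rewrite !psum_cons /= /adj_gaps ?x1' ?(negbTE r1) ?(negbTE l1) /=; lia.
Qed.

Lemma fill_change : psum addn change s' = (psum addn change s + tdelta tr)%N.
Proof.
have d a : change a x = color_step (side a) (col x).
  by rewrite /change /side x1 /=; case: (1 < a)%N.
have d' a : change x a = color_step (side a) (col x).
  by rewrite -d /change andbCA eq_sym.
have c1 a : change a 1 = 0%N by rewrite /change andbF.
have c1' a : change 1 a = 0%N by [].
rewrite /tdelta oldE /tkeep /tcol /= !psum_cat /filling !psum_cons.
case: (k) => [[] []] /=; rewrite !psum_cons /= ?c1 ?c1' ?d ?d'; lia.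
Qed.

(** The links of [l] and [r] to the gap already carry [- t l] and [- t r]. Closing a side adds
    [t x], which completes the distance since [x] is at least as hot as its neighbors. *)
Lemma fill_weight :
  ((1 < l)%N -> t l <= t x) -> ((1 < r)%N -> t r <= t x) ->
  psum +%R weight s' =
  psum +%R weight s + t x *+ tplus tr - t x *+ tminus tr.
Proof.
move=> lx rx.
have x0 : (x == 0%N) = false by case: (x) x1.
have x1' : (x == 1%N) = false by case: (x) x1 => [|[]].
have gt1 a : a != 1%N -> (1 < a)%N = (a != 0%N) by case: a => [|[]].
rewrite /tplus /tminus oldE /tkeep /= !psum_cat /filling !psum_cons /side.
move: lx rx; rewrite !gt1 //.
case: (k) => [[] []] /=; rewrite !psum_cons /= /weight x0 x1' (negbTE l1) (negbTE r1) /= ?orbF;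
  case: (l == 0%N); case: (r == 0%N) => //= lx rx;
  rewrite ?mulr0n ?mulr1n ?mulr2n.
all: try (have {}lx := lx isT; rewrite ?(ger0_norm (_ : 0 <= t x - t l)) ?subr_ge0 //).
all: try (have {}rx := rx isT; rewrite ?(ler0_norm (_ : t r - t x <= 0)) ?subr_le0 //).
all: ring.
Qed.

End Fill.

(** The end markers exclude a gap at the border, and the absence of adjacent gaps excludes a gap as
    a neighbor. *)
Lemma split_gap s g :
  psum addn adj_gaps (0%N :: rcons s 0%N) = 0%N ->
  (g < size (gaps 0 (0%N :: rcons s 0%N)))%N ->
  exists b1 l r b2, [/\ 0%N :: rcons s 0%N = b1 ++ l :: 1%N :: r :: b2,
    l != 1%N, r != 1%N & size (gaps 0 (rcons b1 l)) = g].
Proof.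
rewrite size_gaps => adj lg.
have split a : (g < count_mem 1%N a)%N ->
    exists a1 a2, a = a1 ++ 1%N :: a2 /\ count_mem 1%N a1 = g.
  elim: a g {lg} => // b a IH h /=; case: (eqVneq b 1%N) => [-> /=|b1].
    case: h => [|h]; first by exists [::], a.
    by rewrite add1n ltnS => /IH[a1 [a2 [-> <-]]]; exists (1%N :: a1), a2.
  rewrite add0n => /IH[a1 [a2 [-> <-]]]; exists (b :: a1), a2.
  by rewrite /= (negbTE b1).
have [a1 [a2 [E ca]]] := split _ lg.
case/lastP: a1 => [|b1 l] in E ca *; first by [].
case: a2 => [|r b2] in E *.
  by move: E; rewrite -rcons_cons cats1 => /rcons_inj[].
exists b1, l, r, b2; rewrite size_gaps ca E cat_rcons.
move: adj; rewrite E cat_rcons psum_cat !psum_cons /= => /eqP.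
rewrite !addn_eq0 /adj_gaps => /and4P[_ A1 A2 _]; split=> //.
  by move: A1; case: (l == 1%N).
by move: A2; case: (r == 1%N).
Qed.

(** Looking at the head of the tail already processed merges each run of jobs outside [L] into one
    gap. The right end marker is built in; [stage] adds the left one. *)
Definition collapse L s : seq nat :=
  foldr (fun a c => if L a then a :: c else
                    if head 0%N c == 1%N then c else 1%N :: c) [:: 0%N] s.

Lemma eq_collapse L L' s : {in s, L =1 L'} -> collapse L s = collapse L' s.
Proof.
elim: s => //= a s IH H; rewrite H ?mem_head // IH // => b bs.
by rewrite H // inE bs orbT.
Qed.

Lemma collapse_neq0 L s : collapse L s != [::].
Proof.
elim: s => //= a s IH; case: ifP => // _; case: ifP => //.
Qed.

(** The job [x] lies in a single run of jobs outside [L]. Admitting it splits this run only, and [k]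
    records which of the two remaining parts are non-empty. *)
Lemma collapse_step L L' s1 x s2 :
  {in s1 ++ s2, L =1 L'} -> L' x -> ~~ L x -> all (fun a => (1 < a)%N) (s1 ++ x :: s2) ->
  exists d k r c, [/\ collapse L' (s1 ++ x :: s2) = d ++ filling x k ++ r :: c,
    collapse L (s1 ++ x :: s2) = d ++ 1%N :: r :: c, last 0%N d != 1%N & r != 1%N].
Proof.
move=> LL Lx NLx; rewrite all_cat /= => /and3P[g1 gx g2].
have x1 : (x == 1%N) = false by case: (x) gx => [|[]].
have [k2 [r [c [E1 E2 r1]]]] : exists (k2 : bool) r c,
  [/\ collapse L' (x :: s2) = x :: nseq k2 1%N ++ r :: c,
   collapse L (x :: s2) = 1%N :: r :: c & r != 1%N].
  rewrite /= Lx (negbTE NLx) (eq_collapse (L' := L') (s := s2)); last first.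
    by move=> a a2; apply: LL; rewrite mem_cat a2 orbT.
  (* The tail has no adjacent gaps and ends in a marker, so a gap at its head is followed by some
     [r] that is not a gap. *)
  have : psum addn adj_gaps (collapse L' s2) = 0%N.
    elim: (s2) g2 => [|a s IH] /=; first by rewrite psum1.
    case/andP=> a1 /IH; have a1' : (a == 1%N) = false by case: (a) a1 => [|[]].
    have := collapse_neq0 L' s; case: (collapse L' s) => // b c _ /=.
    by case: ifP => _; [|case: ifP => // b1]; rewrite psum_cons /adj_gaps ?a1' ?b1 //= add0n.
  have : last 0%N (collapse L' s2) = 0%N.
    elim: (s2) => //= a s IH; have := collapse_neq0 L' s; move: IH.
    by case: (collapse L' s) => // b c /= IH _; case: ifP => //; case: ifP.
  have := collapse_neq0 L' s2; case: (collapse L' s2) => // b c _ /=.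
  case: (eqVneq b 1%N) => [->|b1] lc adj; last by exists false, b, c.
  case: c lc adj => // r c lc adj; exists true, r, c; split=> //.
  by move: adj; rewrite psum_cons /adj_gaps /=; case: (r == 1%N).
have [d [k1 [F1 F2 l1]]] : exists d (k1 : bool),
  [/\ collapse L' (s1 ++ x :: s2) = d ++ nseq k1 1%N ++ x :: nseq k2 1%N ++ r :: c,
   collapse L (s1 ++ x :: s2) = d ++ 1%N :: r :: c & last 0%N d != 1%N].
  have {}LL : {in s1, L =1 L'} by move=> a a1; apply: LL; rewrite mem_cat a1.
  elim: s1 LL g1 => [|a s IH] LL /=; first by exists [::], false; rewrite -E2 -E1.
  case/andP => a1 /IH[|d [k1 [F1 F2 l1]]].
    by move=> b bs; apply: LL; rewrite inE bs orbT.
  have a1' : (a == 1%N) = false by case: (a) a1 => [|[]].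
  rewrite /= F1 F2 LL ?mem_head //; case: ifP => _.
    by exists (a :: d), k1; split=> //=; case: d l1 {F1 F2} => //=; rewrite a1'.
  case: d l1 {F1 F2} => [|b d] /= l1.
    by case: k1; exists [::], true; rewrite //= x1.
  by case: ifP => b1; [exists (b :: d), k1|exists (1%N :: b :: d), k1].
exists d, (k1, k2), r, c; split=> //.
by rewrite F1 /filling /= -!catA.
Qed.

End Arrangements.

(** * The dynamic program *)

Definition all_sides : seq (option bool) := [:: None; Some false; Some true].

Fixpoint signatures_upto n : seq (seq gap) :=
  if n is n'.+1 then
    [::] :: [seq g :: l | g <- [seq (a, b) | a <- all_sides, b <- all_sides],
                          l <- signatures_upto n']
  else [:: [::]].

Lemma mem_signatures n l : (size l <= n)%N -> l \in signatures_upto n.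
Proof.
elim: n l => [|n IH] [|[a b] l] // /IH H.
rewrite inE; apply/orP; right; apply: (allpairs_f (@cons gap)) H.
by case: a => [[]|]; case: b => [[]|].
Qed.

(** Locked, like [transitions], so that these long lists are never computed. *)
Definition signatures := locked (signatures_upto 3).

Lemma signaturesE l : (l \in signatures) = (l \in signatures_upto 3).
Proof. by rewrite /signatures -lock. Qed.

Definition transition_candidates : seq transition :=
  [seq (p.1, p.2, q.1, q.2) |
      p <- [seq (l, c) | l <- signatures, c <- [:: false; true]],
      q <- [seq (g, k) | g <- iota 0 3,
             k <- [seq (k1, k2) | k1 <- [:: false; true], k2 <- [:: false; true]]]].

Definition transitions : seq transition :=
  locked [seq tr <- transition_candidates |
      (tsrc tr \in signatures) && (tgap tr < size (tsrc tr))%N &&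
      (tdst tr \in signatures)].

Lemma mem_transitions tr :
  (tgap tr < size (tsrc tr) <= 3)%N -> (size (tdst tr) <= 3)%N ->
  tr \in transitions.
Proof.
case/andP=> lg l3 d3; rewrite /transitions -lock mem_filter lg !signaturesE.
rewrite !mem_signatures //.
case: tr lg l3 {d3} => [[[l c] g] k]; rewrite /tsrc /tgap => lg l3.
pose f (p : seq gap * bool) (q : nat * (bool * bool)) : transition :=
  (p.1, p.2, q.1, q.2).
apply: (allpairs_f f (x := (l, c)) (y := (g, k))).
  apply: (allpairs_f pair); [by rewrite signaturesE mem_signatures | by case: (c)].
apply: (allpairs_f pair); first by rewrite mem_iota (leq_trans lg).
by case: (k) => [[] []].
Qed.

Lemma transitionsP tr : tr \in transitions ->
  [/\ tsrc tr \in signatures, (tgap tr < size (tsrc tr))%N & tdst tr \in signatures].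
Proof. by rewrite /transitions -lock mem_filter -!andbA => /and4P[-> -> ->]. Qed.

(** The successor keeps codes apart from [0], the content of fresh memory. *)
Definition code (tr : transition) : nat := (index tr transitions).+1.

Definition start : seq gap := [:: (None, None)].

Section DynamicProgram.
Variables (R : realType) (t : nat -> R) (col : nat -> bool).
Implicit Types (s xs : seq nat) (L : pred nat).

Local Notation weight := (weight t).
Local Notation change := (change col).
Local Notation gaps := (gaps col).
Local Notation W_sum := (psum +%R weight).
Local Notation C_sum := (psum addn change).

Definition jobs s := all (fun a => 1 < a)%N s.

Lemma head_collapse L b s : (1 < b)%N ->
  (head 0%N (collapse L (b :: s)) == 1%N) = ~~ L b.
Proof.
move=> b1 /=; case: ifP => Lb /=; first by case: (b) b1 => [|[]].
by case: ifP.
Qed.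

(** Every gap but a trailing one ends where a link enters [L]; the successor pays for the trailing
    one. *)
Lemma count_collapse L s : jobs s ->
  (count_mem 1%N (collapse L s) <=
   (psum addn (fun a b => ~~ L a && L b : nat) s).+1)%N.
Proof.
move=> js; have : (count_mem 1%N (collapse L s) =
    psum addn (fun a b => ~~ L a && L b : nat) s
    + (if s is b :: s' then ~~ L (last b s') else false))%N.
  elim: s js => [|a s IH] /=; first by rewrite psum0.
  case/andP=> a1 js; have a1' : (a == 1%N) = false by case: (a) a1 => [|[]].
  move/(_ js): IH; case: s js => [|b s] js IH.
    by rewrite psum1 /=; case: ifP => _ /=; rewrite ?a1'.
  rewrite psum_cons [X in _ = (X + _)%N]/= head_collapse; last by case/andP: js.
  case: ifP => La; first by rewrite [LHS]/= a1' add0n IH.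
  case: ifP => Lb; first by rewrite IH (negbTE Lb).
  by rewrite -cat1s count_cat IH (negbFE Lb) addnA.
move=> ->; rewrite -addn1 leq_add2l.
by case: s {js} => //= b s; case: (L _).
Qed.

Lemma psum_add_fun (f g h : nat -> nat -> nat) s :
  (forall a b, h a b = f a b + g a b)%N ->
  psum addn h s = (psum addn f s + psum addn g s)%N.
Proof. by move=> H; rewrite /psum -big_split; apply: eq_bigr => pq _; exact: H. Qed.

Lemma framed_change s : jobs s ->
  C_sum (0%N :: rcons s 0%N) = psum addn (dist_c col) s.
Proof.
move/allP => gt1; have [Cl Cr] : (forall b, change 0 b = 0%N) /\
    (forall b, change b 0 = 0%N) by split=> b; rewrite /change ?andbF.
elim: s gt1 => [|a [|b s] IH] H /=; first by rewrite psum_cons psum1 psum0.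
  by rewrite !psum_cons !psum1 Cl Cr.
move: IH; rewrite /= !psum_cons Cl => IH; rewrite -IH.
  by rewrite Cl /change /dist_c !H // ?inE ?eqxx ?orbT.
by move=> z zs; apply: H; rewrite inE zs orbT.
Qed.

Lemma framed_weight s : jobs s ->
  W_sum (0%N :: rcons s 0%N) = psum +%R (dist_t t) s.
Proof.
move/allP => gt1; have [Wl Wr] : (forall b, weight 0 b = 0) /\
    (forall b, weight b 0 = 0) by split=> b; rewrite /weight ?orbT.
elim: s gt1 => [|a [|b s] IH] H /=.
- by rewrite psum_cons psum1 psum0 Wl /= addr0.
- by rewrite !psum_cons !psum1 Wl Wr /= !addr0.
move: IH; rewrite /= !psum_cons Wl => IH; rewrite -IH; last first.
  by move=> z zs; apply: H; rewrite inE zs orbT.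
have ha := H a (mem_head _ _).
have hb : (1 < b)%N by apply: H; rewrite !inE eqxx orbT.
rewrite Wl /= !add0r /weight /dist_t.
by case: (a) ha => [|[|a']] //; case: (b) hb => [|[|b']].
Qed.

(** * The table is at least as good as every tame schedule *)

Section Completeness.
Variables (xs s : seq nat).
Hypotheses (xs_uniq : uniq xs) (xs_jobs : jobs xs).
Hypothesis xs_sorted : sorted (fun a b => t a <= t b) xs.
Hypotheses (s_perm : perm_eq s xs) (s_tame : tame col xs s).

Let before i : pred nat := mem (take i xs).
Let stage i := 0%N :: collapse (before i) s.

Let s_jobs : jobs s.
Proof. by rewrite /jobs (perm_all _ s_perm). Qed.

Lemma size_gaps_stage i : (size (gaps 0 (stage i)) <= 3)%N.
Proof.
rewrite size_gaps /stage [count_mem _ _]add0n.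
apply: leq_trans (count_collapse _ s_jobs) _; rewrite ltnS.
rewrite (@psum_add_fun (fun a b => cross col (before i) false a b : nat)
           (fun a b => cross col (before i) true a b : nat)); last first.
  move=> a b; have E z : (z \in before i) = before i z by [].
  by rewrite /cross !E; case: (before i a); case: (before i b); case: (col b).
by have := (s_tame i false, s_tame i true) => -[h1 h2]; exact: leq_add h1 h2.
Qed.

Lemma stage_last : stage (size xs) = 0%N :: rcons s 0%N.
Proof.
rewrite /stage; congr cons.
have : {subset s <= before (size xs)}.
  by move=> a; rewrite (perm_mem s_perm) /before /= take_size.
elim: (s) => //= a s' IH H; rewrite -[_ a]/(a \in before (size xs)) H ?mem_head //.
by rewrite IH // => b bs; rewrite H // inE bs orbT.
Qed.

Lemma stage0 : s != [::] -> stage 0 = [:: 0%N; 1%N; 0%N].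
Proof.
rewrite /stage => s0; congr cons.
suff -> : collapse (before 0) s = if s is _ :: _ then [:: 1%N; 0%N] else [:: 0%N].
  by case: s s0.
by elim: (s) => //= a s' ->; rewrite /before /= take0; case: s'.
Qed.

(** A tame schedule traces a path through the transitions: uncovering its next job refines one gap
    of its own arrangement, and cost and color changes accumulate along the path. *)
Lemma stage_step i (x := nth 0%N xs i) : (i < size xs)%N ->
  exists tr, [/\ tr \in transitions, tsrc tr = gaps 0 (stage i), tcol tr = col x,
    tdst tr = gaps 0 (stage i.+1) &
    W_sum (stage i.+1) = W_sum (stage i) + t x *+ tplus tr - t x *+ tminus tr
    /\ C_sum (stage i.+1) = (C_sum (stage i) + tdelta tr)%N].
Proof.
move=> li; have xx : x \in xs by exact: mem_nth.
have xs' : x \in s by rewrite (perm_mem s_perm).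
have x1 : (1 < x)%N by have /allP := xs_jobs; apply.
have us : uniq s by rewrite (perm_uniq s_perm).
have ix : index x xs = i by rewrite index_uniq.
have lt_before j a : a \in xs -> before j a = (index a xs < j)%N.
  by move=> ax; rewrite /before /= in_take.
have t_le a : before i.+1 a -> t a <= t x.
  rewrite /before /= => ai; have ax := mem_take ai.
  have := @sorted_leq_index _ (fun a b => t a <= t b) _ _ xs xs_sorted a x ax xx.
  apply; [by move=> ? ? ?; apply: le_trans | by move=> ?; exact: lexx |].
  by rewrite ix -ltnS -in_take.
have [s1 [s2 Es]] : exists s1 s2, s = s1 ++ x :: s2.
  by case/splitPr: xs' => s1 s2; exists s1, s2.
have [||||d [k [r [c [E' E l1 r1]]]]] :=
    @collapse_step (before i) (before i.+1) s1 x s2.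
- move=> a a12; have as' : a \in s.
    by rewrite Es mem_cat inE orbCA -mem_cat a12 orbT.
  have ax : a \in xs by rewrite -(perm_mem s_perm).
  rewrite !lt_before // ltnS [RHS]leq_eqVlt -ix; case: eqP => // /(index_inj _).
  move=> /(_ 0%N ax xx) ea; move: us a12; rewrite Es -ea //.
  by rewrite cat_uniq /= mem_cat negb_or => /and3P[_ /andP[/negbTE-> _] /andP[/negbTE-> _]].
- by rewrite lt_before // ix.
- by rewrite lt_before // ix ltnn.
- by rewrite -Es.
rewrite -Es in E E'.
have inst a : a \in collapse (before i.+1) s -> (1 < a)%N -> before i.+1 a.
  elim: (s) => [|b s' IH] /=; first by rewrite inE => /eqP->.
  case: ifP => Lb; first by rewrite inE => /orP[/eqP->|/IH].
  by case: ifP => // _; rewrite inE => /orP[/eqP->|/IH].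
(* The default [0] is the left end marker, so [l] is the left neighbor of the gap even when [d] is
   empty. *)
set l := last 0%N d in l1.
have Ed : 0%N :: d = rcons (belast 0%N d) l by rewrite lastI.
have El : stage i = belast 0%N d ++ l :: 1%N :: r :: c.
  by rewrite /stage E -cat_cons Ed cat_rcons.
have El' : stage i.+1 = belast 0%N d ++ l :: filling x k ++ r :: c.
  by rewrite /stage E' -cat_cons Ed cat_rcons.
pose tr : transition := (gaps 0 (belast 0%N d ++ l :: 1%N :: r :: c), col x,
  size (gaps 0 (rcons (belast 0%N d) l)), k).
have Edst : tdst tr = gaps 0 (stage i.+1) by rewrite El' fill_gaps.
exists tr; split=> //.
- apply: mem_transitions; last by rewrite Edst size_gaps_stage.
  by rewrite fill_gap_lt //= /tsrc /= -El size_gaps_stage.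
- by rewrite El.
rewrite El' El fill_change // (@fill_weight _ t col) //.
- move=> lgt; apply: t_le; apply: inst => //.
  rewrite E' mem_cat; move: lgt; rewrite /l; case: (d) => //= b d' _.
  by rewrite mem_last.
- by move=> rgt; apply/t_le/inst => //; rewrite E' !mem_cat mem_head !orbT.
Qed.

Section Table.
Variables (F : nat -> seq gap -> nat -> nat) (W : nat -> seq gap -> nat -> R).

(** [F r l v] and [W r l v] describe the cheapest way to insert the last [r] jobs
    from signature [l] with at most [v] color changes: [W] is its cost and [F]
    the code of its first transition, or [0] if there is none. *)
Definition usable r v x tr : bool :=
  [&& tcol tr == col x, (tdelta tr <= v)%N
    & F r (tdst tr) (v - tdelta tr) != 0%N].

Definition candidate r v x tr : R :=
  W r (tdst tr) (v - tdelta tr) + t x *+ tplus tr - t x *+ tminus tr.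

Definition good_entry r v x l : Prop :=
  (forall tr, tr \in transitions -> tsrc tr = l -> usable r v x tr ->
     F r.+1 l v != 0%N /\ W r.+1 l v <= candidate r v x tr) /\
  (F r.+1 l v != 0%N -> exists2 tr, tr \in transitions &
     [/\ tsrc tr = l, usable r v x tr, F r.+1 l v = code tr
       & W r.+1 l v = candidate r v x tr]).

(** A remaining gap promises a later job, so once no job is left only the signature without gaps is
    complete. *)
Definition good_base v : Prop :=
  [/\ F 0 [::] v != 0%N, W 0 [::] v = 0
    & forall l, l \in signatures -> F 0 l v != 0%N -> l = [::]].

(** Row [r] of the table concerns the last [r] jobs of [xs]. *)
Definition good_table xs B : Prop := forall v, (v < B)%N -> good_base v /\
  forall r l, (r < size xs)%N -> l \in signatures ->
    good_entry r v (nth 0%N xs (size xs - r.+1)) l.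

End Table.

Lemma table_complete F W B k :
  good_table F W xs B -> (k < B)%N -> s != [::] ->
  (psum addn (dist_c col) s <= k)%N ->
  F (size xs) start k != 0%N /\ W (size xs) start k <= psum +%R (dist_t t) s.
Proof.
move=> good kB s0 sk.
have gt1 : (forall a, a \in s -> 1 < a)%N by apply/allP.
have cE : C_sum (stage (size xs)) = psum addn (dist_c col) s.
  by rewrite stage_last framed_change.
have wE : W_sum (stage (size xs)) = psum +%R (dist_t t) s.
  by rewrite stage_last framed_weight.
(* Backward induction from the finished schedule: at each stage the table continues at least as
   cheaply as the schedule itself does with the same remaining budget. *)
have main r : (r <= size xs)%N -> let i := (size xs - r)%N in
    [/\ (C_sum (stage i) <= k)%N,
      F r (gaps 0 (stage i)) (k - C_sum (stage i))%N != 0%N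
    & W_sum (stage i) + W r (gaps 0 (stage i)) (k - C_sum (stage i))%N
      <= psum +%R (dist_t t) s].
  elim: r => [|r IH] lr i.
    rewrite /i subn0 cE; have [|[F0 W0 _] _] := good (k - psum addn (dist_c col) s)%N.
      by rewrite (leq_ltn_trans _ kB) // leq_subr.
    have -> : gaps 0 (stage (size xs)) = [::].
      apply: size0nil; rewrite size_gaps stage_last -cats1 -cat1s !count_cat /=.
      by rewrite !addn0 add0n; apply/count_memPn; apply/negP => /gt1.
    by rewrite wE W0 addr0.
  have Ei : (size xs - r = i.+1)%N by rewrite /i -subSn.
  have li : (i < size xs)%N by rewrite /i; lia.
  have := IH (ltnW lr); rewrite Ei => -[Ck Fn Wn].
  have [tr [trT trs trc trd [Ew Ec]]] := stage_step li.
  have kC : (C_sum (stage i) <= k)%N by rewrite (leq_trans _ Ck) // Ec leq_addr.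
  have [|_ /(_ r (gaps 0 (stage i)) lr)] := good (k - C_sum (stage i))%N.
    by rewrite (leq_ltn_trans _ kB) // leq_subr.
  case; first by rewrite signaturesE mem_signatures // size_gaps_stage.
  move=> /(_ tr trT trs) H _; move: H; rewrite -/i /usable /candidate trc trd eqxx /=.
  have -> : (k - C_sum (stage i) - tdelta tr = k - C_sum (stage i.+1))%N.
    by rewrite Ec subnDA.
  rewrite Fn andbT => H; have [|F1 W1] := H; first by rewrite leq_subRL // -Ec.
  split=> //; apply: le_trans Wn; rewrite Ew.
  by apply: le_trans (lerD (lexx _) W1) _; rewrite le_eqVlt; apply/orP; left; apply/eqP; ring.
have [] := main _ (leqnn _); rewrite subnn stage0 //.
rewrite /gaps /= /side /=.
have -> : C_sum [:: 0%N; 1%N; 0%N] = 0%N by rewrite !psum_cons psum1 /change.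
have -> : W_sum [:: 0%N; 1%N; 0%N] = 0 by rewrite !psum_cons psum1 /weight /= !addr0.
by rewrite subn0 add0r.
Qed.

End Completeness.

(** * A schedule that attains the value of the table *)

Section Soundness.
Variables (F : nat -> seq gap -> nat -> nat) (W : nat -> seq gap -> nat -> R).
Variables (xs : seq nat) (B k : nat).
Hypothesis good : good_table F W xs B.
Hypothesis kB : (k < B)%N.
Hypotheses (xs_uniq : uniq xs) (xs_jobs : jobs xs).
Hypothesis xs_sorted : sorted (fun a b => t a <= t b) xs.

(** The cost paid so far plus the tabulated cost of the rest stays constant, so when nothing remains
    the schedule costs exactly what the table announced. *)
Definition progress i (a : seq nat) v : Prop :=
  [/\ exists c, [/\ a = 0%N :: rcons c 0%N, (0%N \notin c) &
        perm_eq [seq z <- c | z != 1%N] (take i xs)],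
      psum addn adj_gaps a = 0%N /\ gaps 0 a \in signatures,
      (C_sum a + v <= k)%N,
      F (size xs - i) (gaps 0 a) v != 0%N
    & W_sum a + W (size xs - i) (gaps 0 a) v = W (size xs) start k].

Lemma progress0 : F (size xs) start k != 0%N -> progress 0 [:: 0; 1; 0]%N k.
Proof.
move=> H; rewrite /progress subn0 /gaps /= /side /=; split=> //.
- by exists [:: 1%N]; rewrite take0.
- by split; [rewrite !psum_cons psum1|rewrite signaturesE; exact: mem_signatures].
- by rewrite !psum_cons psum1 /change.
- by rewrite !psum_cons psum1 /weight /= !addr0 add0r.
Qed.

(** Beyond preserving [progress], the conclusion exposes the stored code and the place of the gap,
    because the machine has to retrace this very step. *)
Lemma progress_step i a v (x := nth 0%N xs i) :
  (i < size xs)%N -> progress i a v ->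
  exists tr b1 l r b2, [/\ tr \in transitions, tsrc tr = gaps 0 a /\ tcol tr = col x,
    F (size xs - i) (gaps 0 a) v = code tr,
    [/\ a = b1 ++ l :: 1%N :: r :: b2, count_mem 1%N (rcons b1 l) = tgap tr &
      gaps 0 (b1 ++ l :: filling x (tkeep tr) ++ r :: b2) = tdst tr] &
    progress i.+1 (b1 ++ l :: filling x (tkeep tr) ++ r :: b2) (v - tdelta tr)].
Proof.
move=> li [[c [Ea c0 cP]] [adj sig] Cv Fv Wv].
have x1 : (1 < x)%N by have /allP := xs_jobs; apply; exact: mem_nth.
have Ei : (size xs - i = (size xs - i.+1).+1)%N by lia.
have [|_ /(_ (size xs - i.+1)%N (gaps 0 a))] := good (v := v).
  by apply: leq_ltn_trans kB; apply: leq_trans Cv; exact: leq_addl.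
case=> [||_]; [by lia|by []|rewrite -Ei subKn ?(ltnW li) // -/x => /(_ Fv)].
case=> tr trT [trs /and3P[/eqP trc trd trF] Fc Wc].
have [_ lg dT] := transitionsP trT.
rewrite trs in lg; have := @split_gap col c (tgap tr); rewrite -Ea => /(_ adj lg).
case=> b1 [l [r [b2 [Es l1 r1 Eg]]]].
set a' := b1 ++ l :: filling x (tkeep tr) ++ r :: b2.
have Etr : tr = (gaps 0 (b1 ++ l :: 1%N :: r :: b2), col x,
    size (gaps 0 (rcons b1 l)), tkeep tr).
  by rewrite -Es Eg -trs -trc; case: (tr) => [[[]]].
have Eg' : gaps 0 a' = tdst tr by rewrite /a' fill_gaps // -Etr.
exists tr, b1, l, r, b2; split=> //; first by split=> //; rewrite -(size_gaps col 0).
have Ec' : C_sum a' = (C_sum a + tdelta tr)%N.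
  by rewrite /a' fill_change // -Etr Es.
have le_x z : z \in a -> (1 < z)%N -> t z <= t x.
  rewrite Ea inE mem_rcons inE; case: z => [|[|z]] //= zc _.
  have zt : z.+2 \in take i xs by rewrite -(perm_mem cP) mem_filter.
  have := @sorted_leq_index _ (fun a b => t a <= t b) _ _ xs xs_sorted z.+2 x
    (mem_take zt) (mem_nth _ li).
  apply; [by move=> ? ? ?; apply: le_trans | by move=> ?; exact: lexx |].
  by rewrite (index_uniq 0%N li) // ltnW // -in_take // (mem_take zt).
have Ew' : W_sum a' = W_sum a + t x *+ tplus tr - t x *+ tminus tr.
  rewrite /a' (@fill_weight _ t col) // -?Etr ?Es // => zgt; apply: le_x => //;
    by rewrite Es mem_cat !inE eqxx !orbT.
have [p [q [Ep Eq Ec]]] : exists p q, [/\ rcons b1 l = 0%N :: p,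
    r :: b2 = rcons q 0%N & c = p ++ 1%N :: q].
  move: Es; rewrite Ea -cat_rcons; case E1 : (rcons b1 l) => [|z p].
    by case: (b1) E1.
  case/lastP: (r :: b2) => [|q y].
    by rewrite cats1 -rcons_cons => /rcons_inj[].
  rewrite -[1%N :: rcons q y]rcons_cons -rcons_cat -rcons_cons.
  move=> /rcons_inj[<- E <-].
  by exists p, q.
split.
- exists (p ++ filling x (tkeep tr) ++ q).
  have x0 : (x == 0%N) = false by case: (x) x1.
  have x1' : (x == 1%N) = false by case: (x) x1 => [|[]].
  split.
  + by rewrite /a' -cat_rcons Ep Eq /= -!rcons_cat.
  + have fn : 0%N \notin filling x (tkeep tr).
      rewrite /filling mem_cat in_cons [0%N == x]eq_sym x0.
      by case: (tkeep tr) => [[] []].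
    move: (filling _ _) fn c0 => f /negbTE fn.
    rewrite Ec !mem_cat in_cons fn !negb_or.
    by case/and3P=> -> _ ->.
  rewrite (take_nth 0%N) // -/x perm_sym perm_rcons perm_sym.
  have fx : [seq z <- filling x (tkeep tr) | z != 1%N] = [:: x].
    by rewrite /filling filter_cat /= x1' /=; case: (tkeep tr) => [[] []].
  move: (filling _ _) fx cP => f fx; rewrite Ec !filter_cat fx /= => cP.
  by rewrite -cat1s perm_catCA perm_cons.
- by split; [rewrite /a' fill_adj // -Es | rewrite Eg'].
- by rewrite Ec' -addnA subnKC.
- by rewrite Eg'.
by rewrite Ew' Eg' -Wv Wc /candidate; ring.
Qed.

Lemma progress_final a v : progress (size xs) a v ->
  exists s, [/\ a = 0%N :: rcons s 0%N, perm_eq s xs,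
    (psum addn (dist_c col) s <= k)%N &
    psum +%R (dist_t t) s = W (size xs) start k].
Proof.
case=> [[c [Ea c0 cP]] [adj sig] Cv]; rewrite subnn => Fv Wv.
have [[_ W0 F0] _] := good (v := v) (leq_ltn_trans (leq_trans (leq_addl _ _) Cv) kB).
have Eg := F0 _ sig Fv.
have c1 : 1%N \notin c.
  have := size_gaps col 0 a; rewrite Eg Ea -cats1 -cat1s !count_cat => /esym/eqP.
  by rewrite !addn_eq0 => /and3P[_ /eqP/count_memPn].
have Ec : [seq z <- c | z != 1%N] = c.
  by apply/all_filterP/allP => z zc; apply: contraNneq c1 => <-.
rewrite Ec take_size in cP.
have gt1 : jobs c by rewrite /jobs (perm_all _ cP).
exists c; rewrite -(framed_change gt1) -(framed_weight gt1) -Ea; split=> //.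
  exact: leq_trans (leq_addr _ _) Cv.
by rewrite -Wv Eg W0 addr0.
Qed.

End Soundness.
End DynamicProgram.

(** * The program *)

(** Job [j] is represented by [j + 2], which is also the address of its color
    in the input. Array 3 lists the jobs by increasing temperature, array 11
    holds the current arrangement, and the arrays from 20 on hold the table, one
    array per signature, at address [r * bound + v]. The other arrays are used as
    variables: 4 and 5 are loop counters, 6 a rank, 7 the address of the current
    row, 8 the current job, 9 the signature and 10 the remaining color changes,
    12 the length of the arrangement, 13 to 15 the chosen gap and the gaps to
    keep, 16 the position of that gap and 17 a count of gaps. *)
Definition n_jobs : nexp := NLoad 0 (NConst 0).
Definition ltN e1 e2 : bexp := BNot (BLeN e2 e1).
Definition eqN e1 e2 : bexp := BAnd (BLeN e1 e2) (BLeN e2 e1).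
Definition set_var a e : prog := PN a (NConst 0) e.

(** Ties in temperature are broken by index, so that the ranks are pairwise distinct and each job
    gets a cell of its own. *)
Definition precedes : bexp :=
  BAnd (BLeR (RLoad 0 (var 5)) (RLoad 0 (var 4)))
    (BNot (BAnd (BLeR (RLoad 0 (var 4)) (RLoad 0 (var 5))) (BLeN (var 4) (var 5)))).

Definition sort_jobs : prog :=
  PFor 4 (PIf (ltN (var 4) n_jobs)
    (PSeq (set_var 6 (NConst 0))
    (PSeq (PFor 5 (PIf (ltN (var 5) n_jobs)
             (PIf precedes (set_var 6 (NAdd (var 6) (NConst 1))) PSkip) PSkip))
          (PN 3 (var 6) (NAdd (var 4) (NConst 2)))))
    PSkip).

Definition pseq_all (ps : seq prog) : prog := foldr PSeq PSkip ps.

Definition pswitch (T : Type) (g : T -> bexp) (p : T -> prog) (l : seq T) : prog :=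
  foldr (fun x q => PIf (g x) (p x) q) PSkip l.

Definition tab (l : seq gap) : nat := (20 + index l signatures)%N.

Definition row_addr (v : nexp) : nexp := NAdd (var 7) v.
(** Row [r + 1] starts one bound after row [r]. The machine cannot multiply, so variable 7 carries
    [r * bound] and is updated by addition. *)
Definition new_addr : nexp := NAdd (var 7) (NAdd bound_cell (var 5)).
Definition old_addr tr : nexp := row_addr (NSub (var 5) (NConst (tdelta tr))).

Definition color_test c : bexp :=
  if c then BLeN (NConst 1) (NLoad 0 (var 8))
  else BNot (BLeN (NConst 1) (NLoad 0 (var 8))).

Definition job_temp : rexp := RLoad 0 (NSub (var 8) (NConst 2)).

(** The multiples of the temperature are unrolled into repeated additions and subtractions, at most
    two of each. *)
Definition cand_exp tr : rexp :=
  iter (tminus tr) (fun e => RSub e job_temp)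
    (iter (tplus tr) (fun e => RAdd e job_temp) (RLoad (tab (tdst tr)) (old_addr tr))).

Definition usable_test tr : bexp :=
  BAnd (color_test (tcol tr))
    (BAnd (BLeN (NConst (tdelta tr)) (var 5))
          (BLeN (NConst 1) (NLoad (tab (tdst tr)) (old_addr tr)))).

Definition better_test tr : bexp :=
  BNot (BAnd (BLeN (NConst 1) (NLoad (tab (tsrc tr)) new_addr))
             (BLeR (RLoad (tab (tsrc tr)) new_addr) (cand_exp tr))).

Definition relax tr : prog :=
  PIf (usable_test tr)
    (PIf (better_test tr)
      (PSeq (PN (tab (tsrc tr)) new_addr (NConst (code tr)))
            (PR (tab (tsrc tr)) new_addr (cand_exp tr))) PSkip) PSkip.

(** Straight-line code of constant length: the entries of one column are cleared for all signatures,
    then every transition relaxes the entry of its source. *)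
Definition fill_entries : prog :=
  pseq_all ([seq PN (tab l) new_addr (NConst 0) | l <- signatures]
            ++ [seq relax tr | tr <- transitions]).

Definition fill_table : prog :=
  PSeq (PFor 4 (PN (tab [::]) (var 4) (NConst 1)))
  (PSeq (set_var 7 (NConst 0))
  (PFor 4 (PIf (ltN (var 4) n_jobs)
    (PSeq (set_var 8 (NLoad 3 (NSub n_jobs (NAdd (var 4) (NConst 1)))))
    (PSeq (PFor 5 fill_entries)
          (set_var 7 (NAdd (var 7) bound_cell))))
    PSkip))).

Definition select_test tr : bexp :=
  BAnd (eqN (var 9) (NConst (index (tsrc tr) signatures)))
       (eqN (NLoad (tab (tsrc tr)) (row_addr (var 10))) (NConst (code tr))).

Definition select_action tr : prog :=
  PSeq (set_var 13 (NConst (tgap tr)))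
  (PSeq (set_var 14 (NConst (tkeep tr).1))
  (PSeq (set_var 15 (NConst (tkeep tr).2))
  (PSeq (set_var 9 (NConst (index (tdst tr) signatures)))
        (set_var 10 (NSub (var 10) (NConst (tdelta tr))))))).

(** The current signature is a number in a variable and cannot serve as an array number, so a switch
    over all transitions performs the lookup. *)
Definition select : prog := pswitch select_test select_action transitions.

Definition find_gap : prog :=
  PSeq (set_var 17 (NConst 0))
  (PFor 5 (PIf (ltN (var 5) (var 12))
    (PIf (eqN (NLoad 11 (var 5)) (NConst 1))
      (PSeq (PIf (eqN (var 17) (var 13)) (set_var 16 (var 5)) PSkip)
            (set_var 17 (NAdd (var 17) (NConst 1)))) PSkip) PSkip)).

Definition from_end : nexp := NSub (var 12) (NAdd (var 5) (NConst 1)).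

(** Moves cells to the right starting from the end, so that none is overwritten before it has been
    copied. *)
Definition shift_tail : prog :=
  PFor 5 (PIf (BAnd (ltN (var 5) (var 12)) (ltN (var 16) from_end))
    (PN 11 (NAdd from_end (NAdd (var 14) (var 15))) (NLoad 11 from_end)) PSkip).

Definition insert_job : prog :=
  PSeq find_gap
  (PSeq shift_tail
  (PSeq (PN 11 (NAdd (var 16) (var 14)) (var 8))
  (PSeq (PIf (BLeN (NConst 1) (var 15))
           (PN 11 (NAdd (var 16) (NAdd (var 14) (NConst 1))) (NConst 1)) PSkip)
        (set_var 12 (NAdd (var 12) (NAdd (var 14) (var 15))))))).

Definition build : prog :=
  PFor 4 (PIf (ltN (var 4) n_jobs)
    (PSeq (set_var 8 (NLoad 3 (var 4)))
    (PSeq select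
    (PSeq insert_job
          (set_var 7 (NSub (var 7) bound_cell)))))
    PSkip).

Definition init_build : prog :=
  PSeq (set_var 9 (NConst (index start signatures)))
  (PSeq (set_var 10 (NLoad 0 (NConst 1)))
  (PSeq (PN 11 (NConst 0) (NConst 0))
  (PSeq (PN 11 (NConst 1) (NConst 1))
  (PSeq (PN 11 (NConst 2) (NConst 0))
        (set_var 12 (NConst 3)))))).

Definition write_output : prog :=
  PSeq (PFor 5 (PIf (ltN (var 5) n_jobs)
    (PN 1 (NAdd (var 5) (NConst 2))
       (NSub (NLoad 11 (NAdd (var 5) (NConst 1))) (NConst 2))) PSkip))
  (PSeq (PN 1 (NConst 0) (NAdd n_jobs (NConst 1)))
        (PN 1 (NConst 1) (NConst 1))).

Definition answer_with n : prog :=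
  PSeq (PN 1 (NConst 0) (NConst 1)) (PN 1 (NConst 1) (NConst n)).

(** The empty instance is answered apart: [start] has a gap to be filled, so the table would declare
    that instance infeasible. *)
Definition solver : prog :=
  PIf (BLeN n_jobs (NConst 0)) (answer_with 1)
  (PSeq sort_jobs
  (PSeq fill_table
  (PIf (BLeN (NConst 1)
         (NLoad (tab start) (row_addr (NLoad 0 (NConst 1)))))
    (PSeq init_build (PSeq build write_output))
    (answer_with 0)))).

(** * Arrays written by the program, and its well-formedness *)

Section Syntax.

Lemma tab_neq a l : (a < 20)%N -> (a == tab l) = false /\ (tab l == a) = false.
Proof. by move=> a20; rewrite /tab; split; apply/eqP; lia. Qed.

Lemma writes_pseq_all ps a : writes (pseq_all ps) a = has (writes^~ a) ps.
Proof. by elim: ps => //= p ps ->. Qed.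

Lemma writesR_pseq_all ps a : writesR (pseq_all ps) a = has (writesR^~ a) ps.
Proof. by elim: ps => //= p ps ->. Qed.

Lemma wf_pseq_all ps : wf (pseq_all ps) = all wf ps.
Proof. by elim: ps => //= p ps ->. Qed.

Lemma writes_pswitch (T : eqType) g p (l : seq T) a :
  writes (pswitch g p l) a = has (fun x => writes (p x) a) l.
Proof. by elim: l => //= x l ->. Qed.

Lemma wf_pswitch (T : eqType) g p (l : seq T) :
  wf (pswitch g p l) = all (fun x => wf (p x)) l.
Proof. by elim: l => //= x l ->. Qed.

Lemma writes_fill_entries a : (a < 20)%N -> writes fill_entries a = false.
Proof.
move=> a20; rewrite writes_pseq_all has_cat !has_map.
apply/negbTE; rewrite negb_or; apply/andP; split; apply/hasPn => l _ /=;
  by rewrite (tab_neq _ a20).1.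
Qed.

Lemma writesR_fill_entries a : (a < 20)%N -> writesR fill_entries a = false.
Proof.
move=> a20; rewrite writesR_pseq_all has_cat !has_map.
apply/negbTE; rewrite negb_or; apply/andP; split; apply/hasPn => l _ //=.
by rewrite (tab_neq _ a20).1.
Qed.

Lemma wf_fill_entries : wf fill_entries.
Proof.
by rewrite wf_pseq_all all_cat !all_map; apply/andP; split; apply/allP=> ? _.
Qed.

Lemma writes_select a : a \notin [:: 9; 10; 13; 14; 15]%N -> writes select a = false.
Proof.
move=> H; rewrite /select writes_pswitch; apply/hasPn => tr _ /=.
by move: H; rewrite !inE !negb_or => /and5P[/negbTE-> /negbTE-> /negbTE-> /negbTE-> /negbTE->].
Qed.

Lemma wf_select : wf select.
Proof. by rewrite /select wf_pswitch; apply/allP. Qed.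

Lemma wf_solver : wf solver.
Proof.
rewrite /solver /sort_jobs /fill_table /init_build /build /insert_job /find_gap.
rewrite /shift_tail /write_output /set_var /= wf_fill_entries wf_select.
by rewrite !writes_fill_entries // !writes_select // (tab_neq _ _).1.
Qed.

Lemma solver_bound : writes solver 2 = false.
Proof.
rewrite /solver /sort_jobs /fill_table /init_build /build /insert_job /find_gap.
rewrite /shift_tail /write_output /set_var /=.
by rewrite writes_fill_entries // writes_select // (tab_neq _ _).1.
Qed.

End Syntax.

(** * Correctness of the program *)

Lemma count_sorted_index (T : eqType) (le : rel T) s i :
  total le -> antisymmetric le -> transitive le -> sorted le s -> uniq s ->
  i \in s -> count (fun j => ~~ le i j) s = index i s.
Proof.
move=> le_total le_anti le_trans; elim: s => //= b s IH bs /andP[ub us].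
have le_refl : reflexive le by move=> x; have := le_total x x; case: (le x x).
have ball := order_path_min le_trans bs.
rewrite inE eq_sym; case: (eqVneq b i) => [<- _|bi /= is_].
  rewrite le_refl; apply/eqP; rewrite add0n eqn0Ngt -has_count; apply/hasPn => j js.
  by rewrite negbK (allP ball).
rewrite IH ?(path_sorted bs) //.
suff -> : le i b = false by [].
apply: contraNF bi => ib; apply/eqP/le_anti.
by rewrite ib (allP ball).
Qed.

Lemma sem_if (R : realType) b p q (s : state R) :
  sem (PIf b p q) s = if beval s b then sem p s else sem q s.
Proof. by []. Qed.

Lemma sem_seq (R : realType) p q (s : state R) : sem (PSeq p q) s = sem q (sem p s).
Proof. by []. Qed.

(** * Sorting by counting predecessors *)

Section Sorting.
Variables (R : realType) (s0 : state R).
Let n := nmem s0 0 0.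
Let T := rmem s0 0.

Definition job_le a b := (T a < T b) || ((T a == T b) && (a <= b)%N).

Lemma job_le_total : total job_le.
Proof.
move=> a b; rewrite /job_le; case: (ltrgtP (T a) (T b)) => //= _; exact: leq_total.
Qed.

Lemma job_le_anti : antisymmetric job_le.
Proof.
move=> a b; rewrite /job_le; case: (ltrgtP (T a) (T b)) => //= _.
by move/anti_leq.
Qed.

Lemma job_le_trans : transitive job_le.
Proof.
move=> b a c /orP[ab|/andP[/eqP ab ab']] /orP[bc|/andP[/eqP bc bc']].
- by rewrite /job_le (lt_trans ab bc).
- by rewrite /job_le -bc ab.
- by rewrite /job_le ab bc.
- by rewrite /job_le ab bc eqxx (leq_trans ab' bc') orbT.
Qed.

Let ys := sort job_le (iota 0 n).

Let rank i := count (fun j => ~~ job_le i j) (iota 0 n).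

Let rankE i : (i < n)%N -> rank i = index i ys.
Proof.
move=> li; rewrite /rank.
have /permP -> : perm_eq (iota 0 n) ys by rewrite perm_sym perm_sort.
apply: count_sorted_index; [exact: job_le_total|exact: job_le_anti|
  exact: job_le_trans|exact/sort_sorted/job_le_total| |].
  by rewrite sort_uniq iota_uniq.
by rewrite mem_sort mem_iota.
Qed.

Lemma sort_jobs_correct (xs := mkseq (nmem (sem sort_jobs s0) 3) n) :
  (n <= nmem s0 2 0)%N ->
  perm_eq xs (iota 2 n) /\ sorted (fun a b => T (a - 2) <= T (b - 2)) xs.
Proof.
move=> nB.
have J : forall i, (i < minn (nmem s0 2 0) n)%N ->
    nmem (sem sort_jobs s0) 3 (rank i) = i.+2.
  pose J j (s : state R) := forall i, (i < minn j n)%N -> nmem s 3 (rank i) = i.+2.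
  apply: (@sem_for_ind R J) => //; first by move=> i; rewrite min0n.
  move=> i s iB s4 [FN FR] Js.
  have s00 : nmem s 0 0 = n by rewrite FN.
  have guard : beval s (ltN (var 4) n_jobs) = (i < n)%N by rewrite /= s00 s4 ltnNge.
  rewrite sem_if guard; case: (leqP n i) => [ni|li].
    by move=> m lm; rewrite /= updE /= Js //; move: lm; rewrite !leq_min; lia.
  rewrite !sem_seq; set s1 := sem (set_var 6 _) s; set s2 := sem (PFor 5 _) s1.
  have E6 : nmem s2 6 0 = rank i.
    pose I j (s : state R) :=
      nmem s 6 0 = count (fun j => ~~ job_le i j) (iota 0 (minn j n)).
    have : I (nmem s1 2 0) s2.
      apply: (@sem_for_ind R I) => //; first by rewrite /I min0n.
      move=> j s' jB s'5 [FN' FR'] Is.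
      have s'00 : nmem s' 0 0 = n by rewrite FN'.
      have s'4 : nmem s' 4 0 = i by rewrite FN'.
      have s'T : rmem s' 0 =1 T by move=> z; rewrite FR' // /= FR.
      have guard' : beval s' (ltN (var 5) n_jobs) = (j < n)%N.
        by rewrite /= s'00 s'5 ltnNge.
      rewrite sem_if guard' /I; case: (leqP n j) => [nj|lj].
        by rewrite /= updE /= Is !(minn_idPr _) // (leq_trans nj).
      have prec : beval s' precedes = ~~ job_le i j.
        rewrite /= s'4 s'5 !s'T /job_le negb_or.
        by case: (ltrgtP (T i) (T j)) => //=.
      move: Is; rewrite /I !(minn_idPl _) ?(ltnW lj) // => Is.
      rewrite sem_if prec -[j.+1]addn1 iotaD count_cat add0n /= addn0.
      by case: ifP => _; rewrite /= !updE /= ?updE /= Is ?addn0.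
    by rewrite /I (minn_idPr _) // [nmem s1 2 0]FN.
  move=> m lm; rewrite /= !updE /= E6.
  have -> : nmem s2 4 0 = i by rewrite (sem_frame (p := PFor 5 _)).
  have [->|mi] := eqVneq m i; first by rewrite eqxx addn2.
  have lmi : (m < i)%N by move: lm; rewrite leq_min; lia.
  (* Ranks are positions in a list without duplicates, so placing job [i] does not disturb the jobs
     placed before. *)
  rewrite !rankE // ?(ltn_trans lmi) //.
  case: eqP => [/index_inj|_].
    by move=> /(_ 0%N); rewrite !mem_sort !mem_iota /= => e; move: mi; rewrite e ?eqxx //; lia.
  by rewrite -rankE ?(ltn_trans lmi) // (sem_frame (p := PFor 5 _)) //
    /= updE /= Js // leq_min lmi (ltn_trans lmi).
have Exs : xs = [seq i.+2 | i <- ys].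
  apply: (@eq_from_nth _ 0%N); first by rewrite size_mkseq size_map size_sort size_iota.
  rewrite size_mkseq => r lr; rewrite nth_mkseq // (nth_map 0%N) ?size_sort ?size_iota //.
  have ly : (nth 0%N ys r < n)%N.
    by have := mem_nth 0%N (s := ys) (n := r); rewrite size_sort size_iota mem_sort mem_iota; apply.
  rewrite -[RHS]J ?leq_min ?ly ?(leq_trans ly) //; congr (nmem _ _).
  by rewrite rankE // index_uniq ?sort_uniq ?iota_uniq ?size_sort ?size_iota.
rewrite Exs; split.
  have -> : iota 2 n = [seq i.+2 | i <- iota 0 n] by rewrite -[2%N]addn0 iotaDl.
  by apply: perm_map; rewrite perm_sort.
rewrite sorted_map; apply: (sub_sorted _ (sort_sorted job_le_total _)).
by move=> a b; rewrite /= !subn2 /= => /orP[/ltW|/andP[/eqP->]].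
Qed.

End Sorting.

Lemma sem_pseq_cat (R : realType) ps qs (s : state R) :
  sem (pseq_all (ps ++ qs)) s = sem (pseq_all qs) (sem (pseq_all ps) s).
Proof. by elim: ps s => //= p ps IH s; rewrite IH. Qed.

Lemma sem_pseq_rcons (R : realType) ps p (s : state R) :
  sem (pseq_all (rcons ps p)) s = sem p (sem (pseq_all ps) s).
Proof. by rewrite -cats1 sem_pseq_cat. Qed.

Lemma tab_inj l l' : l \in signatures -> tab l = tab l' -> l = l'.
Proof.
move=> lS; rewrite /tab => /addnI e.
by rewrite -(nth_index [::] lS) e nth_index // -index_mem -e index_mem.
Qed.

(** * Correctness of the table in memory *)

Section Table.
Variables (R : realType) (s0 : state R).
Let n := nmem s0 0 0.
Let B := nmem s0 2 0.
Let T := rmem s0 0.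

Definition temp_of (a : nat) : R := rmem s0 0 (a - 2).
Definition color_of (a : nat) : bool := (0 < nmem s0 0 a)%N.

Definition table_code (s : state R) r l v : nat := nmem s (tab l) (r * nmem s0 2 0 + v).
Definition table_value (s : state R) r l v : R := rmem s (tab l) (r * nmem s0 2 0 + v).

Section Entry.
Variables (s : state R) (r v x : nat).
Hypotheses (sB : nmem s 2 0 = B) (s7 : nmem s 7 0 = (r * B)%N) (s8 : nmem s 8 0 = x).
Hypotheses (s5 : nmem s 5 0 = v) (vB : (v < B)%N).
Hypotheses (sN : nmem s 0 =1 nmem s0 0) (sR : rmem s 0 =1 rmem s0 0).

Let new := (r * B + (B + v))%N.

(** While a column is computed, writes go only to the address [new] of the table arrays and
    candidates are read from row [r], so their values are those of the state on entry. *)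
Definition unchanged_off_new (s' : state R) : Prop := forall a i,
  (a < 20)%N || (i != new) -> nmem s' a i = nmem s a i /\ rmem s' a i = rmem s a i.

Let us tr := usable color_of (table_code s) r v x tr.
Let cand tr := candidate temp_of (table_value s) r v x tr.

Section Eval.
Variables (s1 : state R) (tr : transition).
Hypothesis s1s : unchanged_off_new s1.

Let s1N a i : (a < 20)%N -> nmem s1 a i = nmem s a i.
Proof. by move=> a20; have [] := @s1s a i; rewrite ?a20. Qed.

Lemma eval_new : neval s1 new_addr = new.
Proof. by rewrite /= !s1N // s7 sB s5. Qed.

Lemma eval_old : neval s1 (old_addr tr) = (r * B + (v - tdelta tr))%N.
Proof. by rewrite /= !s1N // s7 s5. Qed.

Let old_neq : (r * B + (v - tdelta tr))%N != new.
Proof. by rewrite /new; lia. Qed.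

Lemma eval_usable : beval s1 (usable_test tr) = us tr.
Proof.
rewrite /usable_test /us /usable.
rewrite -[beval s1 _]/(beval s1 (color_test (tcol tr)) &&
  ((tdelta tr <= nmem s1 5 0) && (0 < nmem s1 (tab (tdst tr)) (neval s1 (old_addr tr)))))%N.
have -> : beval s1 (color_test (tcol tr)) = (tcol tr == color_of x).
  rewrite /color_test /color_of; case: (tcol tr);
    by rewrite /= !s1N // s8 sN; case: (nmem s0 0 x).
rewrite eval_old s1N // s5 lt0n.
by have [| -> _] := @s1s (tab (tdst tr)) (r * B + (v - tdelta tr))%N; first by rewrite old_neq orbT.
Qed.

Lemma eval_cand : reval s1 (cand_exp tr) = cand tr.
Proof.
rewrite /cand_exp /cand /candidate.
have Ht : reval s1 job_temp = temp_of x.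
  rewrite /= s1N // s8 /temp_of -sR.
  by have [] := @s1s 0%N (x - 2)%N.
have E0 : reval s1 (RLoad (tab (tdst tr)) (old_addr tr))
    = table_value s r (tdst tr) (v - tdelta tr)%N.
  rewrite -[LHS]/(rmem s1 (tab (tdst tr)) (neval s1 (old_addr tr))) eval_old.
  by have [|_ ->] := @s1s (tab (tdst tr)) (r * B + (v - tdelta tr))%N; first by rewrite old_neq orbT.
have plus k e : reval s1 (iter k (fun e => RAdd e job_temp) e) = reval s1 e + temp_of x *+ k.
  elim: k => [|k IH]; first by rewrite mulr0n addr0.
  by rewrite iterS -[LHS]/(reval s1 (iter k _ e) + reval s1 job_temp) Ht IH mulrSr addrA.
have minus k e : reval s1 (iter k (fun e => RSub e job_temp) e) = reval s1 e - temp_of x *+ k.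
  elim: k => [|k IH]; first by rewrite mulr0n subr0.
  by rewrite iterS -[LHS]/(reval s1 (iter k _ e) - reval s1 job_temp) Ht IH mulrSr opprD addrA.
by rewrite minus plus E0.
Qed.

Lemma eval_better : beval s1 (better_test tr) =
  ~~ ((0 < nmem s1 (tab (tsrc tr)) new)%N && (rmem s1 (tab (tsrc tr)) new <= cand tr)).
Proof.
rewrite -eval_cand -eval_new.
by [].
Qed.

End Eval.

Definition best_of (done : seq transition) (s1 : state R) l : Prop :=
  (forall tr, tr \in done -> tsrc tr = l -> us tr ->
     nmem s1 (tab l) new != 0%N /\ rmem s1 (tab l) new <= cand tr) /\
  (nmem s1 (tab l) new != 0%N -> exists2 tr, tr \in done &
     [/\ tsrc tr = l, us tr, nmem s1 (tab l) new = code tr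
       & rmem s1 (tab l) new = cand tr]).

Lemma relax_step done s1 tr : tsrc tr \in signatures ->
  unchanged_off_new s1 -> (forall l, l \in signatures -> best_of done s1 l) ->
  unchanged_off_new (sem (relax tr) s1) /\
  (forall l, l \in signatures -> best_of (rcons done tr) (sem (relax tr) s1) l).
Proof.
move=> trS s1s best; rewrite /relax sem_if eval_usable //.
case: (boolP (us tr)) => [u|nu]; last first.
  split=> // l lS; have [b1 b2] := best l lS; split.
    by move=> tr'; rewrite mem_rcons inE => /orP[/eqP->|/b1 //]; rewrite (negbTE nu).
  by move=> /b2[tr' td H]; exists tr' => //; rewrite mem_rcons inE td orbT.
rewrite sem_if eval_better //; case: ifPn => [bt|]; last first.
  rewrite negbK => /andP[nz le_c]; split=> // l lS; have [b1 b2] := best l lS; split.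
    move=> tr'; rewrite mem_rcons inE => /orP[/eqP->|/b1 //] <- _.
    by rewrite -lt0n.
  by move=> /b2[tr' td H]; exists tr' => //; rewrite mem_rcons inE td orbT.
rewrite sem_seq.
have -> : sem (PN (tab (tsrc tr)) new_addr (NConst (code tr))) s1 =
    setN s1 (tab (tsrc tr)) new (code tr) by rewrite -(eval_new s1s).
set s2 := setN s1 _ _ _.
have s2s : unchanged_off_new s2.
  move=> a i H; have [h1 h2] := s1s a i H; split=> //; rewrite /= updE.
  case: ifP => // /andP[/eqP ea /eqP ei]; move: H; rewrite ea ei eqxx orbF.
  by rewrite /tab; lia.
have -> : sem (PR (tab (tsrc tr)) new_addr (cand_exp tr)) s2 =
    setR s2 (tab (tsrc tr)) new (cand tr).
  by rewrite -(eval_new s2s) -(eval_cand _ s2s).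
split.
  move=> a i H; have [h1 h2] := s2s a i H; split=> //; rewrite /= updE.
  case: ifP => // /andP[/eqP ea /eqP ei]; move: H; rewrite ea ei eqxx orbF.
  by rewrite /tab; lia.
move=> l lS; have [b1 b2] := best l lS.
have [el|nl] := eqVneq (tsrc tr) l.
  split; last first.
    by move=> _; exists tr; rewrite ?mem_rcons ?mem_head //= !updE el !eqxx.
  move=> tr'; rewrite mem_rcons inE /= !updE el !eqxx => /orP[/eqP-> _ _|td e' u'] //.
  have [nz lc] := b1 tr' td e' u'; split=> //.
  move: bt; rewrite el lt0n nz /= -ltNge => /ltW; move=> h; exact: le_trans h lc.
have nt : (tab l == tab (tsrc tr)) = false.
  by apply: contraNF nl => /eqP/(tab_inj lS) ->.
split; rewrite /= !updE nt /=.
  move=> tr'; rewrite mem_rcons inE => /orP[/eqP->|/b1 //] e.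
  by rewrite e eqxx in nl.
by move=> /b2[tr' td H]; exists tr' => //; rewrite mem_rcons inE td orbT.
Qed.

Lemma fill_entries_correct (s' := sem fill_entries s) :
  unchanged_off_new s' /\
  forall l, l \in signatures ->
    good_entry temp_of color_of (table_code s') (table_value s') r v x l.
Proof.
rewrite /s' /fill_entries sem_pseq_cat; set s1 := sem (pseq_all (map _ signatures)) s.
have [s1s z1] : unchanged_off_new s1 /\
    forall l, l \in signatures -> nmem s1 (tab l) new = 0%N.
  rewrite /s1; elim/last_ind: (signatures) => [|ls l [H1 H2]] //.
  rewrite map_rcons sem_pseq_rcons.
  set s3 := sem (pseq_all _) s in H1 H2 *.
  have -> : sem (PN (tab l) new_addr (NConst 0)) s3 = setN s3 (tab l) new 0.
    by rewrite -(eval_new H1).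
  split.
    move=> a i H; have [h1 h2] := H1 a i H; split=> //; rewrite /= updE.
    case: ifP => // /andP[/eqP ea /eqP ei]; move: H; rewrite ea ei eqxx orbF.
    by rewrite /tab; lia.
  move=> l'; rewrite mem_rcons inE /= updE eqxx andbT.
  by case: ifP => // nl /orP[/eqP e|/H2 //]; rewrite e eqxx in nl.
have [s2s best] : unchanged_off_new (sem (pseq_all [seq relax tr | tr <- transitions]) s1) /\
    forall l, l \in signatures ->
    best_of transitions (sem (pseq_all [seq relax tr | tr <- transitions]) s1) l.
  have : all (fun tr => tsrc tr \in signatures) transitions.
    by apply/allP => tr /transitionsP[].
  elim/last_ind: (transitions) => [_|trs tr IH].
    by split=> // l lS; split=> // /eqP; case; exact: z1.
  rewrite all_rcons => /andP[trS /IH[H1 H2]].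
  by rewrite map_rcons sem_pseq_rcons; apply: relax_step.
split=> // l lS; have [b1 b2] := best l lS.
set s2 := sem _ s1 in s2s b1 b2 *.
have Eu tr : usable color_of (table_code s2) r v x tr = us tr.
  rewrite /us /usable; congr [&& _, _ & _ != _]; rewrite /table_code.
  by have [|-> _] := s2s (tab (tdst tr)) (r * B + (v - tdelta tr))%N; first by rewrite /new; lia.
have Ec tr : candidate temp_of (table_value s2) r v x tr = cand tr.
  rewrite /cand /candidate; congr (_ + _ - _); rewrite /table_value.
  by have [|_ ->] := s2s (tab (tdst tr)) (r * B + (v - tdelta tr))%N; first by rewrite /new; lia.
have En : (r.+1 * B + v = new)%N by rewrite /new mulSn addnCA addnA.
split; rewrite /table_code /table_value -/B En.
  by move=> tr trT trl; rewrite Eu Ec; apply: b1.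
by move=> /b2[tr trT [h1 h2 h3 h4]]; exists tr => //; rewrite Eu Ec.
Qed.

End Entry.

(** An entry depends on itself and on row [r] up to column [v] only, so it survives all later writes
    to the table. *)
Lemma good_entry_ext (F F' : nat -> seq gap -> nat -> nat)
    (W W' : nat -> seq gap -> nat -> R) r v x l :
  (forall l' w, (w <= v)%N -> F' r l' w = F r l' w /\ W' r l' w = W r l' w) ->
  F' r.+1 l v = F r.+1 l v -> W' r.+1 l v = W r.+1 l v ->
  good_entry temp_of color_of F W r v x l -> good_entry temp_of color_of F' W' r v x l.
Proof.
move=> H EF EW.
have Eu tr : usable color_of F' r v x tr = usable color_of F r v x tr.
  by rewrite /usable; have [-> _] := H (tdst tr) (v - tdelta tr)%N (leq_subr _ _).
have Ec tr : candidate temp_of W' r v x tr = candidate temp_of W r v x tr.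
  by rewrite /candidate; have [_ ->] := H (tdst tr) (v - tdelta tr)%N (leq_subr _ _).
case=> b1 b2; split; rewrite EF EW; first by move=> tr trT trl; rewrite Eu Ec; exact: b1.
by move=> /b2[tr trT [h1 h2 h3 h4]]; exists tr => //; rewrite Eu Ec.
Qed.

Lemma fill_row_correct (s : state R) r x (s' := sem (PFor 5 fill_entries) s) :
  nmem s 2 0 = B -> nmem s 7 0 = (r * B)%N -> nmem s 8 0 = x ->
  nmem s 0 =1 nmem s0 0 -> rmem s 0 =1 rmem s0 0 ->
  (forall a i, (20 <= a)%N -> (i < r.+1 * B)%N ->
     nmem s' a i = nmem s a i /\ rmem s' a i = rmem s a i) /\
  forall v l, (v < B)%N -> l \in signatures ->
    good_entry temp_of color_of (table_code s') (table_value s') r v x l.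
Proof.
move=> sB s7 s8 sN sR.
pose I j (s' : state R) :=
  (forall a i, (20 <= a)%N -> (i < r.+1 * B)%N ->
     nmem s' a i = nmem s a i /\ rmem s' a i = rmem s a i) /\
  forall v l, (v < j)%N -> l \in signatures ->
    good_entry temp_of color_of (table_code s') (table_value s') r v x l.
suff : I (nmem s 2 0) s' by rewrite sB.
apply: (@sem_for_ind R I).
- by rewrite /= wf_fill_entries !writes_fill_entries.
- split=> // a i a20 _; split=> //=; rewrite updE.
  by case: eqP => // ea; move: a20; rewrite ea.
move=> j s1 jB s15 [FN FR] [I1 I2]; rewrite sB in jB.
have fr a : (a < 20)%N -> a != 5%N -> nmem s1 a =1 nmem s a.
  by move=> a20 a5; apply: FN; rewrite /= writes_fill_entries // orbF.
have frR a : (a < 20)%N -> rmem s1 a =1 rmem s a.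
  by move=> a20; apply: FR; rewrite /= writesR_fill_entries.
have [|||||||U G] := @fill_entries_correct s1 r j x;
  [by rewrite fr|by rewrite fr|by rewrite fr|by []|by []|by move=> z; rewrite fr
  |by move=> z; rewrite frR|].
set s2 := sem fill_entries s1 in U G *.
have tabE l i : nmem (incr 5 s2) (tab l) i = nmem s2 (tab l) i.
  by rewrite /= updE (tab_neq _ _).2.
split=> [a i a20 ir|v l].
  have [h1 h2] := I1 a i a20 ir.
  have [|u1 u2] := U a i; first by apply/orP; right; rewrite mulSn in ir; lia.
  split; rewrite /= ?u2 // updE; case: eqP => [ea|_] /=; last by rewrite u1.
  by move: a20; rewrite ea.
rewrite ltnS leq_eqVlt => vj lS.
have [ev|nv] := eqVneq v j.
  by rewrite ev; move: (G l lS); apply: good_entry_ext.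
have lvj : (v < j)%N by move: vj; rewrite (negbTE nv).
move: (I2 v l lvj lS); apply: good_entry_ext => [l' w wv||].
- rewrite /table_code /table_value tabE -/B.
  by apply: (U (tab l') (r * B + w)%N); apply/orP; right; lia.
- rewrite /table_code tabE -/B.
  by have [|-> _] := U (tab l) (r.+1 * B + v)%N; first by apply/orP; right; rewrite mulSn; lia.
rewrite /table_value -/B.
by have [|_ ->] := U (tab l) (r.+1 * B + v)%N; first by apply/orP; right; rewrite mulSn; lia.
Qed.

Lemma fill_table_correct (s' := sem fill_table s0) :
  (n <= B)%N ->
  (forall a i, (20 <= a)%N -> nmem s0 a i = 0%N /\ rmem s0 a i = 0) ->
  good_table temp_of color_of (table_code s') (table_value s') (mkseq (nmem s0 3) n) B /\
  nmem s' 7 0 = (n * B)%N.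
Proof.
move=> nB zero.
rewrite /s' /fill_table 2!sem_seq.
set s1 := sem (PFor 4 (PN (tab [::]) (var 4) (NConst 1))) s0.
have w1 a : a != 4%N -> a != tab [::] -> nmem s1 a =1 nmem s0 a.
  by move=> h1 h2; apply: sem_frame; rewrite /= negb_or h1 h2.
have w1R a : rmem s1 a =1 rmem s0 a by exact: sem_frameR.
have base v : (v < B)%N -> nmem s1 (tab [::]) v = 1%N.
  pose I j (s : state R) := forall v, (v < j)%N -> nmem s (tab [::]) v = 1%N.
  have : I B s1.
    apply: (@sem_for_ind R I) => //.
    move=> j s jB s4 _ Is z; rewrite ltnS leq_eqVlt => zj; rewrite /= !updE (tab_neq _ _).2 // eqxx s4 /=.
    by case: eqP zj => //= _ zj; exact: Is.
  by move=> I1 vB; exact: I1.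
set s2 := sem (set_var 7 (NConst 0)) s1.
have tab2 l i : nmem s2 (tab l) i = nmem s1 (tab l) i by rewrite /= updE (tab_neq _ _).2.
(* Row 0 relies on fresh memory: only the marks of the empty signature are written, while its value
   [0] and the codes [0] of the other signatures are already there. *)
have base2 v : (v < B)%N -> good_base (table_code s2) (table_value s2) v.
  move=> vB; rewrite /good_base /table_code /table_value !mul0n !add0n !tab2 base //.
  split=> //; first by rewrite -[RHS](zero (tab [::]) v _).2 // w1R.
  move=> l lS; rewrite tab2; apply: contraNeq => l0.
  have ll : tab l != tab [::] by apply: contra l0 => /eqP/(tab_inj lS)->.
  have l4 : tab l != 4%N by rewrite (tab_neq _ _).2.
  by rewrite (w1 _ l4 ll) (proj1 (zero (tab l) v _)) // /tab leq_addr.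
pose J j (s : state R) := nmem s 7 0 = (minn j n * B)%N /\
  forall v, (v < B)%N -> good_base (table_code s) (table_value s) v /\
    forall r l, (r < minn j n)%N -> l \in signatures ->
      good_entry temp_of color_of (table_code s) (table_value s) r v
        (nmem s0 3 (n - r.+1)) l.
set body := PIf _ _ _.
have : J B (sem (PFor 4 body) s2).
  have s2B : nmem s2 2 0 = B by rewrite /= updE /= w1 // (tab_neq _ _).1.
  rewrite -s2B; apply: (@sem_for_ind R J).
  - rewrite /body /set_var /= wf_fill_entries !writes_fill_entries //.
  - by rewrite /J min0n; split=> // v vB; split=> //; exact: base2.
  move=> j s jB s4 [FN FR] [J7 Jg]; rewrite s2B in jB.
  have fr a : a \in [:: 0; 2; 3]%N -> nmem s a =1 nmem s0 a.
    move=> ha z; rewrite FN; last first.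
      rewrite /body /set_var /= writes_fill_entries; last by move: ha; rewrite !inE => /or3P[] /eqP->.
      by move: ha; rewrite !inE => /or3P[] /eqP->.
    rewrite /= updE w1; first by move: ha; rewrite !inE => /or3P[] /eqP->.
      by move: ha; rewrite !inE => /or3P[] /eqP->.
    by rewrite (tab_neq _ _).1 //; move: ha; rewrite !inE => /or3P[] /eqP->.
  have frR : rmem s 0 =1 rmem s0 0.
    by move=> z; rewrite FR ?w1R // /body /set_var /= writesR_fill_entries.
  have guard : beval s (ltN (var 4) n_jobs) = (j < n)%N.
    by rewrite /= s4 fr // ltnNge.
  have skip : J j s -> (n <= j)%N -> J j.+1 (incr 4 s).
    move=> [h7 hg] nj; split.
      by rewrite /= updE /= h7 !(minn_idPr _) // (leq_trans nj).
    move=> v vB; have [hb hr] := hg v vB; split; first exact: hb.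
    by move=> r l rm lS; apply: hr => //; move: rm; rewrite !leq_min; lia.
  rewrite /body sem_if guard; case: (leqP n j) => [nj|lj]; first exact: skip.
  rewrite !sem_seq; set s3 := sem (set_var 8 _) s.
  have t3 l i : nmem s3 (tab l) i = nmem s (tab l) i by rewrite /= updE (tab_neq _ _).2.
  have mj : minn j n = j by apply/minn_idPl; exact: ltnW.
  have mj1 : minn j.+1 n = j.+1 by apply/minn_idPl.
  rewrite mj in J7 Jg.
  have x3 : nmem s3 8 0 = nmem s0 3 (n - j.+1).
    by rewrite /= !updE /= s4 addn1 !fr.
  have [|||||U G] := @fill_row_correct s3 j (nmem s0 3 (n - j.+1)).
  - by rewrite /= updE /= fr.
  - by rewrite /= updE.
  - exact: x3.
  - by move=> z; rewrite /= updE /= fr.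
  - by move=> z; rewrite /= frR.
  set s5 := sem (PFor 5 fill_entries) s3 in U G *.
  set s6 := sem (set_var 7 _) s5.
  have e57 : nmem s5 7 0 = (j * B)%N.
    by rewrite /s5 sem_frame ?writes_fill_entries // /= writes_fill_entries.
  have e52 : nmem s5 2 0 = B.
    by rewrite /s5 sem_frame ?writes_fill_entries // /= ?writes_fill_entries // updE /= fr.
  have t6 l i : nmem (incr 4 s6) (tab l) i = nmem s5 (tab l) i.
    by rewrite /= !updE !(tab_neq _ _).2 //= updE (tab_neq _ _).2.
  have t6R l i : rmem (incr 4 s6) (tab l) i = rmem s5 (tab l) i by [].
  have t20 l : (20 <= tab l)%N by rewrite /tab leq_addr.
  have old l i : (i < j.+1 * B)%N -> nmem (incr 4 s6) (tab l) i = nmem s (tab l) i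
      /\ rmem (incr 4 s6) (tab l) i = rmem s (tab l) i.
    by move=> ij; rewrite t6 t6R; have [-> ->] := U (tab l) i (t20 l) ij; rewrite t3.
  split.
    by rewrite mj1 /= !updE /= ?updE /= e57 e52 mulSn addnC.
  move=> v vB; have [hb hr] := Jg v vB; split.
    have lt0 l : nmem (incr 4 s6) (tab l) (0 * nmem s0 2 0 + v) = nmem s (tab l) (0 * nmem s0 2 0 + v)
      /\ rmem (incr 4 s6) (tab l) (0 * nmem s0 2 0 + v) = rmem s (tab l) (0 * nmem s0 2 0 + v).
      by apply: old; rewrite mul0n mulSn; lia.
    case: hb; rewrite /good_base /table_code /table_value => b1 b2 b3.
    split; [by rewrite (lt0 _).1|by rewrite (lt0 _).2|].
    by move=> l lS; rewrite (lt0 _).1; exact: b3.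
  rewrite mj1 => r l; rewrite ltnS leq_eqVlt => rj lS.
  have [er|nr] := eqVneq r j.
    by rewrite er; move: (G v l vB lS); apply: good_entry_ext.
  have lrj : (r < j)%N by move: rj; rewrite (negbTE nr).
  have lrB : (r.+1 * B <= j * B)%N by rewrite leq_mul2r lrj orbT.
  move: (hr r l lrj lS); apply: good_entry_ext => [l' w wv||].
  - by apply: old; rewrite mulSn in lrB *; rewrite -/B; lia.
  - by apply: (proj1 (old _ _ _)); rewrite [X in (_ < X)%N]mulSn -/B; lia.
  by apply: (proj2 (old _ _ _)); rewrite [X in (_ < X)%N]mulSn -/B; lia.
rewrite /J (minn_idPr _) // => -[J7 Jg]; split=> // v vB.
have [hb hr] := Jg v vB; split=> // r l; rewrite size_mkseq => rn lS.
by rewrite nth_mkseq; [exact: hr|lia].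
Qed.

End Table.

Lemma sem_pswitch (R : realType) (T : eqType) g p (l : seq T) x (s : state R) :
  x \in l -> beval s (g x) -> (forall y, y \in l -> beval s (g y) -> y = x) ->
  sem (pswitch g p l) s = sem (p x) s.
Proof.
elim: l => //= y l IH xl gx U; case: ifP => gy.
  by rewrite (U y) ?mem_head.
apply: IH => //; last by move=> z zl; apply: U; rewrite inE zl orbT.
by move: xl; rewrite inE => /orP[/eqP e|//]; rewrite -e gx in gy.
Qed.

Lemma code_inj tr tr' : tr \in transitions -> code tr' = code tr -> tr' = tr.
Proof.
move=> trT [e].
by rewrite -(nth_index tr trT) -e nth_index // -index_mem e index_mem.
Qed.

(** Exactly one guard holds: the test of variable 9 settles the source, hence the array that is
    read, and codes are injective. *)
Lemma select_correct (R : realType) (s : state R) tr :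
  tr \in transitions -> nmem s 9 0 = index (tsrc tr) signatures ->
  nmem s (tab (tsrc tr)) (nmem s 7 0 + nmem s 10 0) = code tr ->
  sem select s = sem (select_action tr) s.
Proof.
move=> trT s9 sc; apply: sem_pswitch => //.
  by rewrite /= s9 sc !leqnn.
move=> tr' trT'; rewrite /= -!eqn_leq s9 => /andP[/eqP ei /eqP ec].
have [S S'] : tsrc tr \in signatures /\ tsrc tr' \in signatures.
  by have [[? _ _] [? _ _]] := (transitionsP trT, transitionsP trT').
have es : tsrc tr' = tsrc tr by apply: (tab_inj S'); rewrite /tab ei.
by apply: code_inj => //; rewrite -ec es sc.
Qed.

Definition holds (R : realType) (a : seq nat) (s : state R) : Prop :=
  nmem s 12 0 = size a /\ forall q, (q < size a)%N -> nmem s 11 q = nth 0%N a q.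

(** * Insertion into the arrangement in memory *)

Section Insert.
Variables (R : realType) (s : state R) (a1 a2 : seq nat) (x : nat) (k : bool * bool).
Let a := a1 ++ 1%N :: a2.
Let p := size a1.
Hypotheses (sB : (size a <= nmem s 2 0)%N) (sa : holds a s).
Hypotheses (s8 : nmem s 8 0 = x) (s13 : nmem s 13 0 = count_mem 1%N a1).
Hypotheses (s14 : nmem s 14 0 = k.1) (s15 : nmem s 15 0 = k.2).

Let gap_index q : (q < size a)%N -> nth 0%N a q = 1%N ->
  (count_mem 1%N (take q a) == count_mem 1%N a1) = (q == p).
Proof.
move=> lq nq; case: (ltngtP q p) => [qp|pq|->].
- rewrite /a take_cat qp -[in X in _ == X](cat_take_drop q a1) count_cat (drop_nth 0%N) //=.
  by move: nq; rewrite /a nth_cat qp => ->; rewrite /=; lia.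
- rewrite /a take_cat ltnNge (ltnW pq) /= count_cat.
  have -> : (q - size a1 = (q - size a1).-1.+1)%N by move: pq; rewrite /p; lia.
  by rewrite /=; lia.
by rewrite /a take_size_cat ?eqxx.
Qed.

Lemma find_gap_correct : nmem (sem find_gap s) 16 0 = p.
Proof.
rewrite /find_gap sem_seq; set s1 := sem (set_var 17 _) s.
pose I q (s' : state R) := nmem s' 17 0 = count_mem 1%N (take q a) /\
  ((p < q)%N -> nmem s' 16 0 = p).
have : I (nmem s1 2 0) (sem (PFor 5 (PIf (ltN (var 5) (var 12))
    (PIf (eqN (NLoad 11 (var 5)) (NConst 1))
      (PSeq (PIf (eqN (var 17) (var 13)) (set_var 16 (var 5)) PSkip)
            (set_var 17 (NAdd (var 17) (NConst 1)))) PSkip) PSkip)) s1).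
  apply: (@sem_for_ind R I) => //; first by rewrite /I take0.
  move=> q s' qB s'5 [FN FR] [I1 I2].
  have s'12 : nmem s' 12 0 = size a by rewrite FN // -(proj1 sa).
  have s'13 : nmem s' 13 0 = count_mem 1%N a1 by rewrite FN.
  have guard : beval s' (ltN (var 5) (var 12)) = (q < size a)%N by rewrite /= s'5 s'12 ltnNge.
  rewrite sem_if guard; case: (leqP (size a) q) => [aq|lq].
    split; first by rewrite /= updE /= I1 !take_oversize // (leq_trans aq).
    by move=> _; rewrite /= updE /= I2 // (leq_trans _ aq) // /a size_cat /= /p; lia.
  have s'11 : nmem s' 11 q = nth 0%N a q by rewrite FN // -(proj2 sa).
  have isgap : beval s' (eqN (NLoad 11 (var 5)) (NConst 1)) = (nth 0%N a q == 1%N).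
    by rewrite /= s'5 s'11 eqn_leq.
  have takeS : count_mem 1%N (take q.+1 a) = (count_mem 1%N (take q a) + (nth 0%N a q == 1%N))%N.
    by rewrite (take_nth 0%N) // -cats1 count_cat /= addn0.
  rewrite sem_if isgap; case: eqP takeS => [nq|nq] takeS; last first.
    split; first by rewrite /= updE /= I1 takeS addn0.
    rewrite ltnS leq_eqVlt => /orP[/eqP e|/I2 h]; last by rewrite /= updE.
    by case: nq; rewrite -e /a nth_cat ltnn subnn.
  rewrite sem_seq sem_if.
  have -> : beval s' (eqN (var 17) (var 13)) = (q == p).
    by rewrite /= I1 s'13 -eqn_leq gap_index.
  case: eqP => [qp|qp].
    by split; rewrite /= !updE /= ?updE /= ?s'5 // I1 takeS.
  split; first by rewrite /= !updE /= I1 takeS.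
  rewrite ltnS leq_eqVlt => /orP[/eqP e|/I2 h]; last by rewrite /= !updE.
  by case: qp.
case=> _; apply; apply: leq_trans sB.
by rewrite /a size_cat /= /p; lia.
Qed.

Let d := (k.1 + k.2)%N.

Lemma shift_tail_correct (s1 : state R) i :
  nmem s1 2 0 = nmem s 2 0 -> nmem s1 12 0 = size a -> nmem s1 16 0 = p ->
  nmem s1 14 0 = k.1 -> nmem s1 15 0 = k.2 ->
  nmem (sem shift_tail s1) 11 i =
  nmem s1 11 (if p + d < i < size a + d then i - d else i)%N.
Proof.
move=> s12 s112 s116 s114 s115.
(* After [j] iterations only destinations from [size a + d - j] on have been written, so the next
   source cell, at [size a - j.+1], still has its original content. *)
pose I j (s' : state R) := forall i, nmem s' 11 i =
  nmem s1 11 (if (p + d < i < size a + d) && (size a + d <= i + j) then i - d else i)%N.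
have : I (nmem s1 2 0) (sem shift_tail s1).
  apply: (@sem_for_ind R I) => //.
    move=> z; rewrite /= updE /= addn0; case: ifP => // /andP[/andP[_ h1] h2]; lia.
  move=> j s' jB s'5 [FN FR] Is.
  have s'12 : nmem s' 12 0 = size a by rewrite FN.
  have s'16 : nmem s' 16 0 = p by rewrite FN.
  have s'14 : nmem s' 14 0 = k.1 by rewrite FN.
  have s'15 : nmem s' 15 0 = k.2 by rewrite FN.
  have E : neval s' from_end = (size a - j.+1)%N by rewrite /= s'12 s'5 addn1.
  have guard : beval s' (BAnd (ltN (var 5) (var 12)) (ltN (var 16) from_end)) =
      (j < size a)%N && (p < size a - j.+1)%N.
    by rewrite -E /= s'5 s'12 s'16 -!ltnNge.
  rewrite sem_if guard; case: ifP => [/andP[ja pj]|np] z; last first.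
    rewrite /= updE /= Is; congr (nmem s1 11 _).
    have -> // : (p + d < z < size a + d)%N && (size a + d <= z + j)%N =
        (p + d < z < size a + d)%N && (size a + d <= z + j.+1)%N.
    by clear -np; lia.
  rewrite -[LHS]/(upd (nmem s') 11
    (neval s' from_end + (nmem s' 14 0 + nmem s' 15 0))%N
    (nmem s' 11 (neval s' from_end)) 11 z).
  rewrite updE eqxx andTb E s'14 s'15 -/d !Is.
  case: eqP => [ez|nz]; congr (nmem s1 11 _).
    rewrite ez addnK; have -> : (p + d < size a - j.+1 + d < size a + d)%N &&
       (size a + d <= size a - j.+1 + d + j.+1)%N by clear -ja pj; lia.
    by case: ifP => //; clear -ja pj; lia.
  have -> // : (p + d < z < size a + d)%N && (size a + d <= z + j)%N =
        (p + d < z < size a + d)%N && (size a + d <= z + j.+1)%N.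
  by clear -nz ja pj; lia.
rewrite /I => ->; congr (nmem s1 11 _); rewrite s12.
by have -> // : (p + d < i < size a + d)%N && (size a + d <= i + nmem s 2 0)%N =
  (p + d < i < size a + d)%N by clear -sB; lia.
Qed.

Let a' := a1 ++ filling x k ++ a2.

Let nth_fill i : nth 0%N a' i =
  if (i < p)%N then nth 0%N a i else
  if (i <= p + d)%N then nth 0%N (filling x k) (i - p) else nth 0%N a (i - d).
Proof.
have sf : size (filling x k) = d.+1.
  by rewrite /filling size_cat /= !size_nseq /d addnS.
rewrite /a' /a; move: (filling _ _) sf => f sf.
rewrite !nth_cat sf -/p; case: (ltnP i p) => // pi.
have -> : (i - p < d.+1)%N = (i <= p + d)%N by clear -pi; lia.
case: (leqP i (p + d)) => // di.
have -> : (i - d < p)%N = false by clear -di; lia.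
have -> : (i - d - p = (i - p - d.+1).+1)%N by clear -di; lia.
by [].
Qed.

Lemma insert_job_correct : holds a' (sem insert_job s).
Proof.
rewrite /insert_job !sem_seq; set s1 := sem find_gap s.
have s1p : nmem s1 16 0 = p by exact: find_gap_correct.
have fr z : z \notin [:: 5; 16; 17]%N -> nmem s1 z =1 nmem s z.
  by rewrite !inE !negb_or => /and3P[/negbTE h1 /negbTE h2 /negbTE h3]; apply: sem_frame; rewrite /= h1 h2 h3.
have s112 : nmem s1 12 0 = size a by rewrite fr // (proj1 sa).
have [s114 s115] : nmem s1 14 0 = k.1 /\ nmem s1 15 0 = k.2 by rewrite !fr.
set s2 := sem shift_tail s1.
have fr2 z : z \notin [:: 5; 11]%N -> nmem s2 z =1 nmem s1 z.
  by rewrite !inE !negb_or => /andP[/negbTE h1 /negbTE h2]; apply: sem_frame; rewrite /= h1 h2.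
have s211 i : nmem s2 11 i = nmem s1 11 (if (p + d < i < size a + d)%N then i - d else i)%N.
  by apply: shift_tail_correct => //; rewrite fr.
have e8 : nmem s2 8 0 = x by rewrite fr2 // fr.
have e12 : nmem s2 12 0 = size a by rewrite fr2.
have e14 : nmem s2 14 0 = k.1 by rewrite fr2.
have e15 : nmem s2 15 0 = k.2 by rewrite fr2.
have e16 : nmem s2 16 0 = p by rewrite fr2.
have sa' : size a' = (size a + d)%N.
  by rewrite /a' /a /filling !size_cat /= !size_nseq /d; clear; lia.
have sap : (p < size a)%N by rewrite /a size_cat /= /p; clear; lia.
have old q : (q < size a)%N -> nmem s1 11 q = nth 0%N a q.
  by move=> qa; rewrite fr // (proj2 sa).
have ap : nth 0%N a p = 1%N by rewrite /a nth_cat ltnn subnn.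
set s3 := sem (PN 11 _ _) s2.
have E3 i : nmem s3 11 i = if i == (p + k.1)%N then x else nmem s2 11 i.
  by rewrite /= updE /= e16 e14 e8.
have e3 z i : z != 11%N -> nmem s3 z i = nmem s2 z i.
  by move=> /negbTE z11; rewrite /= updE z11.
set s4 := sem (PIf _ _ _) s3.
have E4 i : nmem s4 11 i = if k.2 && (i == p + k.1.+1)%N then 1%N else nmem s3 11 i.
  rewrite /s4 sem_if -[beval _ _]/(0 < nmem s3 15 0)%N e3 // e15; case: (k.2) => //.
  rewrite -[LHS]/(upd (nmem s3) 11 (nmem s3 16 0 + (nmem s3 14 0 + 1)) 1 11 i)%N.
  by rewrite updE eqxx !andTb (e3 16%N) // (e3 14%N) // e16 e14 addn1 addnS.
have e4 z i : z != 11%N -> nmem s4 z i = nmem s2 z i.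
  move=> z11; rewrite -e3 // /s4 sem_if; case: ifP => //= _.
  by rewrite updE (negbTE z11).
split.
  by rewrite /= updE /= !e4 // e12 e14 e15 sa'.
move=> q; rewrite sa' => qa.
have -> : nmem (sem (set_var 12 (NAdd (var 12) (NAdd (var 14) (var 15)))) s4) 11 q = nmem s4 11 q by [].
rewrite E4 E3 s211 nth_fill.
case: (ltnP q p) => qp.
  have -> : (q == (p + k.1.+1)%N) = false by clear -qp; lia.
  have -> : (q == (p + k.1)%N) = false by clear -qp; lia.
  rewrite andbF; have -> : (p + d < q < size a + d)%N = false by clear -qp; lia.
  by rewrite old // (ltn_trans qp).
case: (leqP q (p + d)) => qd; last first.
  have -> : k.2 && (q == (p + k.1.+1)%N) = false.
    by move: qd; rewrite /d; case: (k.2) => //=; clear; lia.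
  have -> : (q == (p + k.1)%N) = false by move: qd; rewrite /d; clear; lia.
  by rewrite qa old //; move: qa qd; rewrite /d; clear; lia.
rewrite andFb.
move: qd (old (q : nat)); rewrite -(subnKC qp) addKn !eqn_add2l leq_add2l /d.
case: (q - p)%N => [|[|[|e]]]; rewrite /filling; case: (k) => [[] []] //=.
all: by rewrite !addn0 ap => _; apply.
Qed.

End Insert.

Lemma size_signatures l : l \in signatures -> (size l <= 3)%N.
Proof.
rewrite signaturesE; elim: (3%N) l => [|m IH] l; first by rewrite inE => /eqP->.
rewrite inE => /orP[/eqP-> //|/allpairsP[[g l'] [_ /IH h ->]]].
by rewrite /= ltnS.
Qed.

(** The 5 stands for at most three gaps and two end markers; the lemma ensures that loops up to the
    bound scan the whole arrangement. *)
Lemma progress_size (R : realType) (t : nat -> R) col F W xs k i a v :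
  progress t col F W xs k i a v -> (size a <= size xs + 5)%N.
Proof.
case=> [[c [Ea _ cP]] [_ sig] _ _ _].
have h1 := size_signatures sig; rewrite size_gaps Ea -cats1 /= count_cat /= in h1.
have h2 := perm_size cP; rewrite size_filter size_take_min in h2.
have h3 := count_predC (pred1 1%N) c.
have h4 : count (predC (pred1 1%N)) c = count (fun z => z != 1%N) c by [].
have h5 := geq_minr i (size xs).
rewrite Ea -cats1 /= size_cat /= -h3 h4 h2.
move: h1 h5; rewrite add0n !addn0.
move=> u3 wz; apply: (@leq_ltn_trans (3 + size xs + 1)); last by clear; lia.
by rewrite leq_add2r; exact: leq_add.
Qed.

(** * Reconstruction of a schedule in memory *)

Section Build.
Variables (R : realType) (s0 sT : state R).
Let n := nmem s0 0 0.
Let B := nmem s0 2 0.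
Let k := nmem s0 0 1.
Let xs := mkseq (nmem s0 3) n.
Let t := temp_of s0.
Let col := color_of s0.
Let F := table_code s0 sT.
Let W := table_value s0 sT.
Hypotheses (good : good_table t col F W xs B) (nB : (n + 10 <= B)%N) (kB : (k < B)%N).
Hypotheses (xs_uniq : uniq xs) (xs_jobs : jobs xs).
Hypothesis xs_sorted : sorted (fun a b => t a <= t b) xs.
Hypotheses (sT0 : nmem sT 0 =1 nmem s0 0) (sT2 : nmem sT 2 0 = B).
Hypotheses (sT3 : nmem sT 3 =1 nmem s0 3) (sT7 : nmem sT 7 0 = (n * B)%N).

Let size_xs : size xs = n.
Proof. by rewrite size_mkseq. Qed.

Lemma build_correct : F n start k != 0%N ->
  exists a v, progress t col F W xs k n a v /\ holds a (sem build (sem init_build sT)).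
Proof.
move=> F0; set si := sem init_build sT.
pose J j (s : state R) := exists a v,
  [/\ progress t col F W xs k (minn j n) a v, holds a s,
    nmem s 9 0 = index (gaps col 0 a) signatures, nmem s 10 0 = v
    & nmem s 7 0 = ((n - minn j n) * B)%N].
have w_init a : a \notin [:: 9; 10; 11; 12]%N -> nmem si a =1 nmem sT a.
  rewrite !inE !negb_or => /and4P[/negbTE h1 /negbTE h2 /negbTE h3 /negbTE h4].
  by apply: sem_frame; rewrite /= h1 h2 h3 h4.
have siB : nmem si 2 0 = B by rewrite w_init.
have : J (nmem si 2 0) (sem build si).
  apply: (@sem_for_ind R J).
  - rewrite /insert_job /find_gap /shift_tail /set_var /= wf_select.
    by rewrite !writes_select.
  - exists [:: 0; 1; 0]%N, k; rewrite min0n; split.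
    + by apply: progress0; rewrite size_xs.
    + by split=> // [[|[|[|q]]]].
    + by rewrite /gaps /= /side.
    + by rewrite -[LHS]/(nmem sT 0 1) sT0.
    by rewrite subn0 -sT7; apply: w_init.
  move=> j s jB s4 [FN _] [a [v [pr ha h9 h10 h7]]].
  have fr z : z \in [:: 0; 2; 3]%N \/ (20 <= z)%N -> nmem s z =1 nmem sT z.
    move=> hz q; rewrite FN; last first.
      rewrite /build /insert_job /find_gap /shift_tail /set_var /= writes_select.
        by case: hz; [rewrite !inE => /or3P[] /eqP-> | case: z => //; do 19! case=> //].
      by case: hz; [rewrite !inE => /or3P[] /eqP-> | case: z => //; do 19! case=> //].
    apply: w_init.
    by case: hz; [rewrite !inE => /or3P[] /eqP-> | case: z => //; do 19! case=> //].
  have s00 : nmem s 0 0 = n by rewrite fr ?sT0 //; left.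
  have guard : beval s (ltN (var 4) n_jobs) = (j < n)%N by rewrite /= s4 s00 ltnNge.
  rewrite sem_if guard; case: (leqP n j) => [nj|lj].
    exists a, v; rewrite (minn_idPr (leq_trans nj (leqnSn _))).
    by move: pr h7; rewrite (minn_idPr nj) => pr h7; split.
  move: pr h7; rewrite (minn_idPl (ltnW lj)) => pr h7.
  have ljx : (j < size xs)%N by rewrite size_xs.
  have sza := progress_size pr; rewrite size_xs in sza.
  have [tr [b1 [l [r [b2 [trT [trs trc] trF [Ea Eg Ed] pr']]]]]] :=
    progress_step good kB xs_uniq xs_jobs xs_sorted ljx pr.
  set x := nth 0%N xs j in trc pr' Ed.
  have xE : x = nmem s0 3 j by rewrite /x nth_mkseq.
  rewrite 3!sem_seq; set s1 := sem (set_var 8 _) s.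
  have s18 : nmem s1 8 0 = x by rewrite /= updE /= s4 fr ?sT3 //; left.
  have s1f z : z != 8%N -> nmem s1 z =1 nmem s z.
    by move=> /negbTE z8; apply: sem_frame; rewrite /= z8.
  have sel : sem select s1 = sem (select_action tr) s1.
    apply: select_correct => //.
      by rewrite s1f // h9 trs.
    rewrite !s1f // h10 h7 trs fr; last by right; rewrite /tab leq_addr.
    by rewrite -[RHS]trF /F /table_code size_xs.
  rewrite sel; set s2 := sem (select_action tr) s1.
  have s2f z : z \notin [:: 9; 10; 13; 14; 15]%N -> nmem s2 z =1 nmem s1 z.
    rewrite !inE !negb_or => /and5P[/negbTE g1 /negbTE g2 /negbTE g3 /negbTE g4 /negbTE g5].
    by apply: sem_frame; rewrite /= g1 g2 g3 g4 g5.
  have ha2 : holds (rcons b1 l ++ 1%N :: r :: b2) s2.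
    rewrite cat_rcons -Ea; split; first by rewrite s2f // s1f // (proj1 ha).
    by move=> q lq; rewrite s2f // s1f // (proj2 ha).
  set s3 := sem insert_job s2.
  have H : holds (b1 ++ l :: filling x (tkeep tr) ++ r :: b2) s3.
    rewrite -cat_rcons; apply: insert_job_correct => //.
    rewrite cat_rcons -Ea s2f // s1f // fr ?sT2; last by left.
    by move: sza nB; clear; lia.
  have s3f z : z \notin [:: 5; 11; 12; 16; 17]%N -> nmem s3 z =1 nmem s2 z.
    rewrite !inE !negb_or => /and5P[/negbTE g1 /negbTE g2 /negbTE g3 /negbTE g4 /negbTE g5].
    by apply: sem_frame; rewrite /= g1 g2 g3 g4 g5.
  set s5 := sem (set_var 7 _) s3.
  have s5f z : z \notin [:: 4; 7]%N -> nmem (incr 4 s5) z =1 nmem s3 z.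
    rewrite !inE !negb_or => /andP[/negbTE g1 /negbTE g2] q.
    rewrite -[LHS]/(upd (nmem s5) 4 0 (nmem s5 4 0 + 1) z q)%N updE g1 andFb.
    by apply: sem_frame; rewrite /= g2.
  have [_ _ dT] := transitionsP trT.
  exists (b1 ++ l :: filling x (tkeep tr) ++ r :: b2), (v - tdelta tr)%N.
  rewrite (minn_idPl lj); split=> //.
  - by rewrite Ed s5f // s3f // /s2 /= !updE.
  - by rewrite s5f // s3f // /s2 /= !updE /= ?updE /= h10.
  have e2 : nmem s3 2 0 = B by rewrite s3f // s2f // s1f // fr //; left.
  have e7 : nmem s3 7 0 = ((n - j) * B)%N by rewrite s3f // s2f // s1f.
  rewrite -[LHS]/(nmem s3 7 0 - nmem s3 2 0)%N e2 e7.
  by rewrite subnS -subn1 [RHS]mulnBl mul1n.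
rewrite /J siB (minn_idPr _); last by move: nB; clear; lia.
by case=> a [v [pr ha _ _ _]]; exists a, v.
Qed.

End Build.

Lemma write_output_correct (R : realType) (s : state R) c :
  (size c <= nmem s 2 0)%N -> nmem s 0 0 = size c ->
  holds (0%N :: rcons c 0%N) s ->
  output (sem write_output s) = 1%N :: [seq a - 2 | a <- c]%N.
Proof.
move=> sB s0 [_ s11]; rewrite /write_output 2!sem_seq.
set s1 := sem (PFor 5 _) s.
have e1 q : (q < size c)%N -> nmem s1 1 (q + 2) = (nth 0%N c q - 2)%N.
  pose I j (s' : state R) := forall q, (q < minn j (size c))%N ->
    nmem s' 1 (q + 2) = (nth 0%N c q - 2)%N.
  have : I (nmem s 2 0) s1.
    apply: (@sem_for_ind R I) => //; first by move=> z; rewrite min0n.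
    move=> j s' jB s'5 [FN _] Is.
    have guard : beval s' (ltN (var 5) n_jobs) = (j < size c)%N.
      by rewrite /= s'5 FN // s0 ltnNge.
    rewrite sem_if guard; case: (leqP (size c) j) => [cj|lj] z zj.
      by apply: Is; move: zj; rewrite !leq_min; move: cj; clear; lia.
    rewrite -[LHS]/(upd (nmem s') 1 (nmem s' 5 0 + 2)
      (nmem s' 11 (nmem s' 5 0 + 1) - 2) 1 (z + 2))%N updE eqxx andTb eqn_add2r s'5.
    have s'11 : nmem s' 11 (j + 1) = nth 0%N c j.
      by rewrite FN // s11 /= ?size_rcons addn1 //= ?nth_rcons ?lj // ltnS ltnW.
    case: eqP => [->|zn]; first by rewrite s'11.
    by apply: Is; move: zj zn; rewrite !leq_min; clear; lia.
  by move=> H qc; apply: H; rewrite leq_min qc (leq_trans qc).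
have s10 : nmem s1 0 0 = size c by rewrite sem_frame.
rewrite /output -[nmem _ 1 0]/(nmem s1 0 0 + 1)%N s10.
apply: (@eq_from_nth _ 0%N); first by rewrite size_mkseq /= size_map addn1.
rewrite size_mkseq => -[|q] lq; rewrite nth_mkseq //.
rewrite /= (nth_map 0%N) -?e1; [|by move: lq; clear; lia..].
by rewrite addn2.
Qed.

(** * Conclusion *)

Lemma horner_nat_mono (p : {poly nat}) a b : (a <= b)%N -> (p.[a] <= p.[b])%N.
Proof.
move=> ab; rewrite !horner_coef.
elim: (size p) => [|m IH]; first by rewrite !big_ord0.
rewrite !big_ord_recr /=; apply: leq_add => //.
apply: leq_mul => //; elim: (m) => [|i IHi]; first by rewrite !expr0.
by rewrite !exprS; apply: leq_mul.
Qed.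

(** * Schedules as sequences of job numbers *)

Section Instances.
Variables (R : realType) (P : instance R).
Let n := njobs P.
Implicit Types S : seq 'I_(njobs P).

Definition job_codes S : seq nat := [seq (nat_of_ord p).+2 | p <- S].

Lemma psum_job_codes (V : Type) (idx : V) (op : Monoid.com_law idx) f S :
  psum op f (job_codes S) =
  \big[op/idx]_(pq <- zip S (behead S)) f (nat_of_ord pq.1).+2 (nat_of_ord pq.2).+2.
Proof.
elim: S => [|p [|q S] IH]; rewrite ?psum0 ?psum1 /= ?big_nil //.
by rewrite psum_cons IH big_cons.
Qed.

Lemma perm_job_codes S : perm_eq (job_codes S) (iota 2 n) = is_schedule S.
Proof.
have -> : iota 2 n = job_codes (enum 'I_n).
  by rewrite /job_codes (map_comp (fun a => a.+2) (@nat_of_ord n)) val_enum_ord -[2%N]addn0 iotaDl.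
apply/idP/idP => [|H]; last by apply: perm_map.
by move/(perm_map_inj (f := fun p : 'I_n => (nat_of_ord p).+2)); apply => p q [] /val_inj.
Qed.

Lemma job_codes_onto c : perm_eq c (iota 2 n) -> exists S, c = job_codes S.
Proof.
move=> cP; have : all (fun a => 2 <= a < n + 2)%N c.
  apply/allP => a; rewrite (perm_mem cP) mem_iota addnC; by [].
elim: c {cP} => [|a c IH] /=; first by exists [::].
case/andP=> /andP[a2 an] /IH[S ->].
have an' : (a - 2 < n)%N by move: a2 an; clear; lia.
exists (Ordinal an' :: S); congr cons => /=.
by move: a2; clear; lia.
Qed.

End Instances.

Theorem corollary4p1 (R : realType) : poly_time_solvable (scheduling_problem R).
Proof.
(* The first instruction, of cost 6, sets the bound of all loops. The 10 leaves room for an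
   arrangement of length [n + 5] and for the budgets, which are at most [n + 2]. *)
exists (Seq (StoreN 2 (NConst 0) (NAdd n_jobs (NConst 10))) (compile solver)).
exists (time_poly solver + 6%:P) => P [_ _ k_le].
set w := encode _; set n := njobs P.
pose s0 := setN (init_state w) 2 0 (n + 10).
(* Each of the [n] colors contributes at least one unit to the size of the input. *)
have n_size : (n <= word_size w)%N.
  rewrite /word_size; apply: leq_trans (leq_addr _ _).
  rewrite -[n](size_enum_ord n) -(size_map (fun p => nat_of_bool (color p))).
  set l := map _ _; rewrite /w /= -/l !big_cons !addnA; apply: leq_trans (leq_addl _ _).
  elim: l => [|a l IH]; first by rewrite big_nil.
  by rewrite big_cons /= -add1n; apply: leq_add.
have [t [et lt]] := exec_compile (s := s0) (m := n) wf_solver (negbT solver_bound) erefl.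
exists (6 + t)%N, (sem solver s0); split.
- by apply: ExSeq et; exact: ExStoreN.
- rewrite hornerD hornerC addrC; apply: leq_add => //.
  by apply: leq_trans lt _; exact: horner_nat_mono.
have N0 : nmem s0 0 0 = n by [].
rewrite /solver sem_if -[beval _ _]/(nmem s0 0 0 <= 0)%N N0.
case: (leqP n 0) => [|n_gt0].
  rewrite leqn0 => /eqP n0; left; exists [::]; last by [].
  have nil_of (S : seq 'I_(njobs P)) : is_schedule S -> S = [::].
    by move=> /perm_size h; apply: size0nil; rewrite h size_enum_ord.
  have sch0 : is_schedule ([::] : seq 'I_(njobs P)).
    rewrite /is_schedule; suff -> : enum 'I_(njobs P) = [::] by [].
    by apply: size0nil; rewrite size_enum_ord.
  split; first by split=> //; rewrite /color_changes big_nil.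
  by move=> S' [/nil_of -> _].
rewrite 2!sem_seq; set s1 := sem sort_jobs s0; set sT := sem fill_table s1.
have fr1 z : z \notin [:: 3; 4; 5; 6]%N -> nmem s1 z =1 nmem s0 z.
  rewrite !inE !negb_or => /and4P[/negbTE h1 /negbTE h2 /negbTE h3 /negbTE h4].
  by apply: sem_frame; rewrite /= h1 h2 h3 h4.
have fr1R z : rmem s1 z =1 rmem s0 z by exact: sem_frameR.
have N1 : nmem s1 0 0 = n by rewrite fr1.
have B1 : nmem s1 2 0 = (n + 10)%N by rewrite fr1.
set k := max_changes P in k_le.
have K1 : nmem s1 0 1 = k by rewrite fr1.
have kB : (k < n + 10)%N.
  have : (ncolor P false <= n)%N by rewrite /ncolor -[n]card_ord max_card.
  by move: k_le; move: (ncolor P false) (ncolor P true) => u v; clear; lia.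
pose t1 := temp_of s1; pose col := color_of s1.
have tE (p : 'I_(njobs P)) : t1 p.+2 = temp p.
  rewrite /t1 /temp_of fr1R subn2 /= (nth_map p) ?size_enum_ord //.
  by rewrite nth_ord_enum.
have cE (p : 'I_(njobs P)) : col p.+2 = color p.
  rewrite /col /color_of fr1 // -[nmem s0 0 _]/(nth 0%N
    [seq nat_of_bool (color p) | p <- enum 'I_(njobs P)] p).
  rewrite (nth_map p) ?size_enum_ord //.
  by rewrite nth_ord_enum; case: (color p).
have tempE (S : seq 'I_(njobs P)) : temp_change S = psum +%R (dist_t t1) (job_codes S).
  by rewrite psum_job_codes; apply: eq_bigr => pq _; rewrite /dist_t !tE.
have changeE (S : seq 'I_(njobs P)) : color_changes S = psum addn (dist_c col) (job_codes S).
  rewrite psum_job_codes; apply: eq_bigr => pq _; rewrite /dist_c !cE.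
  by case: (color pq.1); case: (color pq.2).
set xs := mkseq (nmem s1 3) n.
have [xs_perm xs_sorted] : perm_eq xs (iota 2 n) /\ sorted (fun a b => t1 a <= t1 b) xs.
  have [|h1 h2] := @sort_jobs_correct R s0; first by rewrite N0 leq_addr.
  split=> //; apply: (sub_sorted _ h2) => a b.
  by rewrite /t1 /temp_of !fr1R.
have xs_uniq : uniq xs by rewrite (perm_uniq xs_perm) iota_uniq.
have xs_jobs : jobs xs.
  by apply/allP => a; rewrite (perm_mem xs_perm) mem_iota => /andP[].
have [||good T7] := @fill_table_correct R s1.
- by rewrite N1 B1 leq_addr.
- move=> a i a20; have ne z : (z < 20)%N -> (a == z) = false.
    by move=> z20; apply/eqP => az; move: a20; rewrite az leqNgt z20.
  rewrite fr1 ?fr1R; last by rewrite !inE !ne.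
  by rewrite /= updE !ne.
rewrite -/sT N1 -/xs in good T7.
have T0 : nmem sT 0 =1 nmem s1 0.
  by apply: sem_frame; rewrite /fill_table /= writes_fill_entries // (tab_neq _ _).1.
have T2 : nmem sT 2 0 = nmem s1 2 0.
  by apply: sem_frame; rewrite /fill_table /= writes_fill_entries // (tab_neq _ _).1.
have T3 : nmem sT 3 =1 nmem s1 3.
  by apply: sem_frame; rewrite /fill_table /= writes_fill_entries // (tab_neq _ _).1.
set F := table_code s1 sT in good; set W := table_value s1 sT in good.
(* Serves twice: its first half justifies the answer that nothing is feasible, its second half the
   optimality of the schedule built. An arbitrary schedule is made tame before it is compared with
   the table. *)
have complete (S : seq 'I_(njobs P)) : feasible S -> F n start k != 0%N /\ W n start k <= temp_change S.
  case=> SP Sk; rewrite -perm_job_codes -/n in SP.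
  have Sxs : perm_eq (job_codes S) xs by rewrite (permPr xs_perm).
  have [s [sP sT1 sC sTame]] := tame_exists col xs_uniq xs_sorted Sxs.
  have [|||] := table_complete xs_uniq xs_jobs xs_sorted sP sTame good (k := k).
  - by rewrite B1.
  - by rewrite -size_eq0 (perm_size sP) size_mkseq -lt0n.
  - by rewrite (leq_trans sC) // -changeE.
  by rewrite size_mkseq => F0 W0; split=> //; rewrite tempE (le_trans W0).
rewrite sem_if.
have -> : beval sT (BLeN (NConst 1) (NLoad (tab start) (row_addr (NLoad 0 (NConst 1))))) =
    (F n start k != 0%N).
  by rewrite -[LHS]/(0 < nmem sT (tab start) (nmem sT 7 0 + nmem sT 0 1))%N T7 T0 K1 lt0n.
case: ifP => F0; last first.
  by right; split=> // S /complete[]; rewrite F0.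
have [a [v [pr ha]]] : exists a v, progress t1 col F W xs k n a v /\
    holds a (sem build (sem init_build sT)).
  have := @build_correct R s1 sT; rewrite N1 K1 B1 -/xs => H; apply: H => //.
  - by rewrite -B1.
  - by rewrite T2.
  by rewrite T7 B1.
have size_xs : size xs = n by rewrite size_mkseq.
rewrite B1 in good; rewrite -size_xs in pr.
have [c [Ea cP cC cT]] := progress_final good kB xs_jobs pr.
have [S Ec] : exists S : seq 'I_(njobs P), c = job_codes S.
  by apply: job_codes_onto; rewrite (permPl cP).
left; exists S.
  split; first by split; rewrite ?changeE -?Ec // -perm_job_codes -Ec (permPl cP).
  by move=> S' /complete[_ W_le]; rewrite tempE -Ec cT size_xs.
set sB := sem build _ in ha.
have frB z : z \in [:: 0; 2]%N -> nmem sB z =1 nmem sT z.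
  move=> hz q; rewrite /sB sem_frame; last first.
    rewrite /build /insert_job /find_gap /shift_tail /set_var /= writes_select.
      by move: hz; rewrite !inE => /orP[] /eqP->.
    by move: hz; rewrite !inE => /orP[] /eqP->.
  by rewrite sem_frame //; move: hz; rewrite !inE => /orP[] /eqP->.
have size_c : size c = n by rewrite (perm_size cP).
rewrite !sem_seq -/sB.
have cB : (size c <= nmem sB 2 0)%N by rewrite frB // T2 B1 size_c leq_addr.
have cN : nmem sB 0 0 = size c by rewrite frB // T0 N1 size_c.
rewrite Ea in ha; rewrite (write_output_correct cB cN ha).
by rewrite Ec /job_codes -map_comp; congr cons; apply: eq_map => p /=; rewrite subn2.
Qed.
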